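(* Let $\mathbf{k}$ be a field of characteristic zero, let $k\ge 2$ and $m\ge 0$ be integers and $n=k+2m$. Let $I_{n,k}=(x_1^2,\dots,x_n^2,(x_1+\cdots+x_n)^k)\subset\mathbf{k}[x_1,\dots,x_n]$, let $\mathrm{in}(I_{n,k})$ be its initial ideal with respect to a term ordering with $x_1\succ\cdots\succ x_n$, and write $\beta_{i,j}=\beta_{i,j}(\mathrm{in}(I_{n,k}))$. Then: (1) $\beta_{0,2}=n+1$ if $k=2$, $\beta_{0,2}=n$ if $k>2$, and $\beta_{0,j}=C^{k-1}_{j-k}$ for all $k\le j\le k+m$ with $j\neq 2$. (2) For $i=1,\dots,k-3$: $\beta_{i,2(i+1)}=\binom{n}{i+1}$, and $\beta_{i,j}=0$ for all $j<i+k$ with $j\ne 2(i+1)$. (3) $\beta_{k-1+2i,\,k-1+2i+k+i}=C^{k-1}_{i+1}$ for $i=0,\dots,m$. (4) For $i=0,\dots,m$ the following hold: - $\beta_{k-1+2i,\,k-1+2i+j}=0$ for all $j<k+i$; - $\beta_{k-1+2i,\,k-1+2i+j}\neq 0$ for all $k+i<j\le k+m$; - $\beta_{j,\,j+(k+i)}=0$ for all $j>k-1+2i$; - $\beta_{j,\,j+(k+i)}\ne 0$ for all $0\le j<k-1+2i$. In particular, the Betti diagram of $\mathrm{in}(I_{n,k})$ (the entry in column $i$ and row $j$ being $\beta_{i,i+j}$) has the following shape: its non-zero rows are rows $2,\dots,k+m$; for $2\le r\le k-1$ row $r$ has exactly one non-zero entry, in column $r-2$ (equal to $n$ if $r=2$);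 and for $0\le i\le m$ row $k+i$ has non-zero entries exactly in columns $0,1,\dots,k-1+2i$, the entry in column $0$ being $C_i^{k-1}$ (except that it is $n+1$ if $k=2$ and $i=0$) and the entry in column $k-1+2i$ being $C_{i+1}^{k-1}$.
   Context: For a graded ideal $I$, $\beta_{i,j}(I)$ is the number of generators of degree $j$ of the $i$-th free module $F_i$ in the minimal graded free resolution $\cdots\to F_1\to F_0\to I\to 0$ of the ideal $I$ itself (so $\beta_{0,j}$ counts minimal generators of degree $j$). $C_i=\binom{2i}{i}-\binom{2i}{i-1}$ is the $i$-th Catalan number, and $C^{k-1}_r$ is the coefficient of $t^r$ in $\left(\sum_{i\ge 0}C_it^i\right)^k$ (the $(k-1)$-fold convolution of the Catalan sequence). *)

(* Defs.v *)
From HB Require Import structures.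
From mathcomp Require Import all_boot all_order all_algebra.
From mathcomp Require Import mpoly.

Set Implicit Arguments.
Unset Strict Implicit.
Unset Printing Implicit Defensive.

Import GRing.Theory.
Local Open Scope ring_scope.

(* The case split gives 'C(0, -1) = 0, hence [catalan 0 = 1]: with [i.-1] the
   truncated predecessor would give ['C(0, 0) - 'C(0, 0) = 0]. *)
Definition catalan (i : nat) : nat :=
  ('C(2 * i, i) - (if i is i'.+1 then 'C(2 * i, i') else 0))%N.

(* The l-fold convolution C^l_r: the coefficient of t^r in the (l+1)-st power of
   the Catalan generating series, which may be truncated above degree r. *)
Definition catalan_conv (l r : nat) : nat :=
  (((\poly_(i < r.+1) catalan i) ^+ l.+1)`_r)%R.

Section Ideals.
Variables (K : fieldType) (n : nat).
Implicit Types (A I : {mpoly K[n]} -> Prop) (p q : {mpoly K[n]}).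

Definition ideal_span A p : Prop :=
  exists2 s : seq ({mpoly K[n]} * {mpoly K[n]}),
    (forall cq, cq \in s -> A cq.2) & p = \sum_(cq <- s) cq.1 * cq.2.

Record term_order (le : rel 'X_{1..n}) : Prop := TermOrder {
  term_order_total : total le;
  term_order_anti : antisymmetric le;
  term_order_trans : transitive le;
  term_order_ge0 : forall u, le 0%MM u;
  term_order_add : forall u v w, le u v -> le (u + w)%MM (v + w)%MM
}.

Definition decreasing_vars (le : rel 'X_{1..n}) : Prop :=
  forall i j : 'I_n, (i < j)%N -> le U_(j)%MM U_(i)%MM && ~~ le U_(i)%MM U_(j)%MM.

(* [mpoly.mlead] is the leading monomial for one fixed ordering only, so the
   leading monomial for an arbitrary term ordering is defined here; the zero
   polynomial has none. *)
Definition is_leading_monomial (le : rel 'X_{1..n}) p (u : 'X_{1..n}) : Prop :=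
  u \in msupp p /\ {in msupp p, forall v, le v u}.

Definition initial_ideal (le : rel 'X_{1..n}) I : {mpoly K[n]} -> Prop :=
  ideal_span (fun q => exists p u,
    [/\ I p, is_leading_monomial le p u & q = 'X_[u]]).

Definition squares_power_ideal (k : nat) : {mpoly K[n]} -> Prop :=
  ideal_span (fun q =>
    (exists i : 'I_n, q = 'X_i ^+ 2) \/ q = (\sum_(i < n) 'X_i) ^+ k).

(* Minimal graded free resolution  ... -> F_1 -> F_0 -> I -> 0  of the ideal I.
   F_i is free with basis e_a (a < mgfr_rank i), e_a having degree
   [mgfr_deg i a]; elements of F_i are row vectors and matrices act on the
   right.  Degrees can be taken in nat, since a minimal generator of F_i cannot
   have negative degree.  [mgfr_minimal] says that the image of F_(i+1) lies in
   (x_1, ..., x_n) F_i. *)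
Record min_graded_free_res I := MinGradedFreeRes {
  mgfr_rank : nat -> nat;
  mgfr_deg : forall i, 'I_(mgfr_rank i) -> nat;
  mgfr_aug : 'cV[{mpoly K[n]}]_(mgfr_rank 0);
  mgfr_diff : forall i, 'M[{mpoly K[n]}]_(mgfr_rank i.+1, mgfr_rank i);
  mgfr_aug_homog : forall a, mgfr_aug a 0 \is (mgfr_deg a).-homog;
  mgfr_diff_homog : forall i a b,
    {in msupp (mgfr_diff i a b),
      forall u, (mdeg u + mgfr_deg b)%N = mgfr_deg a};
  mgfr_aug_image : forall p,
    I p <-> exists v : 'rV_(mgfr_rank 0), p = (v *m mgfr_aug) 0 0;
  mgfr_aug_exact : forall v : 'rV_(mgfr_rank 0),
    v *m mgfr_aug = 0 <-> exists w, v = w *m mgfr_diff 0;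
  mgfr_diff_exact : forall i (v : 'rV_(mgfr_rank i.+1)),
    v *m mgfr_diff i = 0 <-> exists w, v = w *m mgfr_diff i.+1;
  mgfr_minimal : forall i a b, (mgfr_diff i a b)@_0%MM = 0
}.

Definition graded_betti I (F : min_graded_free_res I) (i j : nat) : nat :=
  #|[set a : 'I_(mgfr_rank F i) | mgfr_deg a == j]|.

End Ideals.

Arguments squares_power_ideal : clear implicits.

(* Main.v *)
(* Write a set P as a lattice walk going up at the elements of P and down at the
   others; call P below k if the walk stays strictly below height k.

   Standard monomials. The squarefree monomials x_P with P below k form the
   standard monomials of the ideal. For such P, matching up-steps with earlier
   down-steps gives a product of factors x_i - x_b and of fewer than k variables;
   applied as a differential functional it kills the ideal, and x_P is its lowest
   monomial, so x_P is not a leading monomial. Conversely, comparing the powers of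
   x + l and l modulo x^2 and inducting on the number of variables, the x_P with
   P below k span the quotient (here char 0 is needed), so every other monomial
   is a leading one.

   Betti numbers. Dimension shifting along the resolution, using exactness of the
   Koszul complex K over the polynomial ring S, identifies the generators of F_i
   with a basis of H_(i+1)(K / in(I) K). In a fixed multidegree the latter
   complex has a basis of cells x_P e_T with P below k; pairing P with P + {t}, where
   t is the largest index of exponent 1 in the multidegree, leaves only critical
   cells, and strong stability makes them cycles, so that they form a basis of
   homology. A critical cell contributes to column #|T| - 1 and row #|P| + 1.

   Counting. A critical cell with P <> T satisfies #|T| + k <= 2 (#|P| + 1), with
   equality only if T is an initial segment of the variables; the extremal cells are
   counted by the reflection principle and ballot numbers. *)

Require Import Defs.
From mathcomp Require Import all_boot all_order all_algebra.
From mathcomp Require Import mpoly.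
From mathcomp Require Import zify ring.

Set Implicit Arguments.
Unset Strict Implicit.
Unset Printing Implicit Defensive.
Import GRing.Theory.

(** * Subset complexes *)

Section SubsetComplex.
Local Open Scope ring_scope.
Variables (R : comNzRingType) (n : nat).
Implicit Types (j l t : 'I_n) (s r U : {set 'I_n}) (c : {set 'I_n} -> R).

Definition ksign j s : R := (-1) ^+ #|[set l in s | (l < j)%N]|.

(** A chain is given by its coefficients. The boundary deletes one index from a cell, so its
    coefficient at [s] collects those of the cells [j |: s]; [U] will be the support of a
    multidegree. *)
Definition subset_diff U c s : R :=
  \sum_(j in U :\: s) ksign j s * c (j |: s).

Lemma ksignU1 j t s : t \notin s ->
  ksign j (t |: s) = (-1) ^+ (t < j)%N * ksign j s.
Proof.
move=> ts; rewrite /ksign -exprD; congr (_ ^+ _).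
have [tj|tj] := ltnP t j.
  have -> : [set l in t |: s | (l < j)%N] = t |: [set l in s | (l < j)%N].
    by apply/setP=> l; rewrite !inE; case: eqP => // ->; rewrite tj.
  by rewrite cardsU1 inE (negPf ts).
congr #|pred_of_set _|; apply/setP=> l; rewrite !inE.
by case: eqP => //= ->; rewrite ltnNge tj /= andbF.
Qed.

Lemma ksign_sq j s : ksign j s * ksign j s = 1.
Proof. by rewrite /ksign -expr2 sqrr_sign. Qed.

Lemma ksign_swap j t s : j != t -> j \notin s -> t \notin s ->
  ksign j (t |: s) * ksign t (j |: s) = - (ksign t s * ksign j s).
Proof.
move=> jt js ts; rewrite !ksignU1 // mulrACA.
have -> : (-1) ^+ (t < j)%N * (-1) ^+ (j < t)%N = -1 :> R.
  by move: jt; rewrite -val_eqE neq_ltn => /orP[] h;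
    rewrite h ltnNge ltnW //= ?expr1 ?expr0 ?mulr1 ?mul1r.
by rewrite mulN1r mulrC.
Qed.

Lemma ksign_swap2 j t s : j != t -> j \notin s -> t \notin s ->
  ksign j s * ksign t (j |: s) = - (ksign t s * ksign j (t |: s)).
Proof.
move=> jt js ts; rewrite !ksignU1 //.
move: jt; rewrite -val_eqE neq_ltn => /orP[] h;
  rewrite h ltnNge ltnW //= ?expr1 ?expr0 ?mulr1 ?mul1r.
  by rewrite mulN1r mulrN mulrC.
by rewrite mulN1r mulrN opprK mulrC.
Qed.

(** The terms at (x, y) and (y, x) cancel. The order [lt] chooses one term of each pair, which
    avoids a division by 2. *)
Lemma antisym_sum (T : finType) (P : pred T) (lt : rel T) (g : T -> T -> R) :
  (forall x y, x != y -> lt x y = ~~ lt y x) ->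
  (forall x y, P x -> P y -> x != y -> g x y = - g y x) ->
  \sum_(x | P x) \sum_(y | P y && (y != x)) g x y = 0.
Proof.
move=> ltP gN.
under eq_bigr => x Px.
  rewrite (bigID (fun y => lt x y)) /=.
  under [X in _ + X]eq_bigr => y /andP[/andP[Py yx] _].
    rewrite gN // 1?eq_sym //; over.
  rewrite sumrN; over.
rewrite sumrB /= [X in _ - X](exchange_big_dep P) /=; last by move=> ? ? _ /andP[/andP[]].
apply/eqP; rewrite subr_eq0; apply/eqP/eq_bigr => x Px.
apply/eq_bigl => y; case: (P y) => //=; case: (eqVneq y x) => [->|yx] /=.
  by rewrite andbF.
by rewrite Px /= ltP // eq_sym.
Qed.

Lemma subset_diffK U c s : subset_diff U (subset_diff U c) s = 0.
Proof.
pose g j l := ksign j s * ksign l (j |: s) * c (l |: (j |: s)).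
rewrite -[RHS](@antisym_sum _ (mem (U :\: s)) (fun j l => (j < l)%N) g).
- apply: eq_bigr => j jUs; rewrite /subset_diff mulr_sumr.
  rewrite (eq_bigl (fun l => (l \in U :\: s) && (l != j))).
    by apply: eq_bigr => l _; rewrite mulrA.
  by move=> l; rewrite !inE negb_or -andbA andbC -andbA [_ && (l != j)]andbC.
- by move=> j l; rewrite -val_eqE; case: ltngtP.
- move=> j l; rewrite !inE => /andP[js _] /andP[ls _] jl.
  by rewrite /g ksign_swap2 // mulNr setUCA.
Qed.

Lemma eq_subset_diff U c c' s :
  (forall j, j \in U :\: s -> c (j |: s) = c' (j |: s)) ->
  subset_diff U c s = subset_diff U c' s.
Proof. by move=> h; apply: eq_bigr => j /h->. Qed.

(* X selects the basis elements that survive in a quotient of the full complex;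
   the homotopy pairs s :\ t with s, and subset_retr is the identity minus the
   graded commutator of homotopy and differential. *)
Section Homotopy.
Variables (U : {set 'I_n}) (X : pred {set 'I_n}) (t : 'I_n).
Hypothesis tU : t \in U.
Hypothesis upX : forall s j, X s -> j \in U -> X (j |: s).

Definition subset_htpy c s : R :=
  if (t \in s) && X (s :\ t) then ksign t (s :\ t) * c (s :\ t) else 0.

Definition subset_retr c s : R :=
  c s - subset_diff U (subset_htpy c) s - subset_htpy (subset_diff U c) s.

Lemma subset_htpy_support c s : t \notin s -> subset_htpy c s = 0.
Proof. by rewrite /subset_htpy => /negPf->. Qed.

(** The homotopy formula dh + hd = id at a surviving cell that is not critical. If [t] is in [s],
    the terms through [t] return [c s] and the others cancel by anticommutation of signs; otherwise
    only j = t contributes to dh. *)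
Lemma subset_retr_eq0 c s : X s -> ~~ ((t \in s) && ~~ X (s :\ t)) ->
  subset_retr c s = 0.
Proof.
move=> Xs; rewrite negb_and negbK /subset_retr.
case: (boolP (t \in s)) => [ts /= Xst | ts _].
  rewrite {2}/subset_htpy ts Xst /=.
  have tst : t \in U :\: (s :\ t) by rewrite !inE eqxx.
  rewrite {2}/subset_diff (bigD1 t) //= setD1K // mulrDr mulrA ksign_sq mul1r.
  rewrite opprD addrACA subrr add0r -opprD; apply/eqP; rewrite oppr_eq0.
  rewrite mulr_sumr.
  have -> : subset_diff U (subset_htpy c) s =
    \sum_(j in U :\: s) - (ksign t (s :\ t) * (ksign j (s :\ t) * c (j |: s :\ t))).
    apply: eq_bigr => j; rewrite inE => /andP[js jU].
    have jt : j != t by apply: contraNneq js => ->.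
    have tj : t \notin s :\ t by rewrite !inE eqxx.
    have js' : j \notin s :\ t by rewrite !inE (negPf js) andbF.
    have E : (j |: s) :\ t = j |: (s :\ t).
      by apply/setP=> l; rewrite !inE; case: (eqVneq l j) => //= ->; rewrite jt.
    rewrite /subset_htpy inE ts orbT E upX //= mulrA -{1}(setD1K ts).
    by rewrite ksign_swap // mulNr mulrA.
  rewrite sumrN addrC subr_eq0; apply/eqP.
  apply: eq_bigl => j; rewrite !inE.
  by case: (eqVneq j t) => [->|_] /=; rewrite ?ts ?andbT ?andbF.
rewrite (subset_htpy_support _ ts) subr0 /subset_diff (bigD1 t) ?inE ?ts //=.
rewrite big1 ?addr0 => [|j /andP[_ jt]].
  rewrite /subset_htpy setU11 setU1K // Xs /= mulrA ksign_sq mul1r subrr //.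
by rewrite subset_htpy_support ?mulr0 // !inE eq_sym (negPf jt).
Qed.

Definition critical s := [&& X s, t \in s & ~~ X (s :\ t)].

Hypothesis critical_min : forall s j, critical s -> j \in s -> ~~ X (s :\ j).

(** No coface of a critical cell is critical, by [critical_min]. On the cofaces the homotopy formula
    therefore gives c - hdc = dhc, and applying d once more gives ddhc = 0. *)
Lemma subset_retr_diff c s : critical s ->
  subset_diff U c s - subset_diff U (subset_htpy (subset_diff U c)) s = 0.
Proof.
move=> cs; have Xs : X s by case/and3P: cs.
have E j : j \in U :\: s -> c (j |: s) - subset_htpy (subset_diff U c) (j |: s)
    = subset_diff U (subset_htpy c) (j |: s).
  rewrite inE => /andP[js jU]; have Xj : X (j |: s) by exact: upX.
  apply/eqP; rewrite -subr_eq0 addrAC; apply/eqP; apply: subset_retr_eq0 => //.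
  apply/negP => /andP[tj nX].
  have cj : critical (j |: s) by rewrite /critical Xj tj nX.
  by have := critical_min cj (setU11 _ _); rewrite setU1K // Xs.
rewrite -[RHS](subset_diffK U (subset_htpy c) s) -sumrB.
by apply: eq_bigr => j /E <-; rewrite mulrBr.
Qed.

End Homotopy.
End SubsetComplex.

(** * Koszul complexes *)

Section Koszul.
Local Open Scope ring_scope.
Variables (K : fieldType) (n : nat).
Implicit Types (j t : 'I_n) (s T P : {set 'I_n}) (a u v : 'X_{1..n}).

Lemma mcoeff_bounded_sum (E : 'X_{1..n} -> K) d v :
  (forall v, E v != 0 -> (mdeg v < d)%N) ->
  (\sum_(v : 'X_{1..n < d}) E v *: 'X_[v])@_v = E v.
Proof.
move=> hE; have [vd|dv] := ltnP (mdeg v) d; first by rewrite mcoeff_mpoly.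
rewrite raddf_sum /= big1 => [|w _].
  by apply/esym/eqP; apply: contraTT dv => /hE; rewrite -ltnNge.
rewrite mcoeffZ mcoeffX; case: eqP => [wv|]; last by rewrite mulr0.
by have := bmdeg w; rewrite wv ltnNge dv.
Qed.

Lemma mcoeff_mulXi j (p : {mpoly K[n]}) v :
  ('X_j * p)@_v = if v j != 0%N then p@_(v - U_(j)) else 0.
Proof.
rewrite mpoly_mulC; case: ifP => [vj|vj].
  by rewrite -{1}(submK (_ : U_(j) <= v)%MM) ?lep1mP // addmC mcoeffMX.
apply/eqP; rewrite mcoeff_eq0 (perm_mem (msuppMX _ _)).
apply/mapP => -[w _ E]; move: vj; rewrite E mnmDE mnm1E eqxx.
by [].
Qed.

Lemma mesym1E s j : mesym1 s j = (j \in s).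
Proof. exact: mnmE. Qed.

Definition msupport a : {set 'I_n} := [set j | a j != 0%N].

Lemma mesym1_le s a : (mesym1 s <= a)%MM = (s \subset msupport a).
Proof.
apply/mnm_lepP/subsetP => h j; have := h j; rewrite ?mesym1E ?inE.
  by move=> {}h js; move: h; rewrite js; case: (a j).
by case: (j \in s) => //= /(_ isT); case: (a j).
Qed.

Lemma msupport_addr s v : s \subset msupport (v + mesym1 s)%MM.
Proof. by rewrite -mesym1_le lem_addl. Qed.

Lemma mesym1D1 s t : t \in s -> mesym1 s = (mesym1 (s :\ t) + U_(t))%MM.
Proof.
move=> ts; apply/mnmP => j; rewrite mnmDE !mesym1E mnm1E !inE.
by case: (eqVneq j t) => [->|jt]; rewrite ?ts ?eqxx //= addn0.
Qed.

Lemma mesym1U1 s t : t \notin s -> mesym1 (t |: s) = (mesym1 s + U_(t))%MM.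
Proof. by move=> ts; rewrite (mesym1D1 (setU11 t s)) setU1K. Qed.

Definition koszul_diff r (f : {set 'I_n} -> 'rV[{mpoly K[n]}]_r) s :=
  \sum_(j | j \notin s) (ksign _ j s * 'X_j) *: f (j |: s).

(** The strand of [f] in multidegree [a]: the coefficient of x^(a - s) e_s. As the subtraction of
    monomials is truncated, this is meaningful only for [s] inside the support of [a]. *)
Definition slice r a (b : 'I_r) (f : {set 'I_n} -> 'rV[{mpoly K[n]}]_r) s : K :=
  (f s 0 b)@_(a - mesym1 s).

Lemma mcoeff_ksignM j s (p : {mpoly K[n]}) v :
  (ksign _ j s * p)@_v = ksign K j s * p@_v.
Proof.
rewrite /ksign; set e := #|_|.
by rewrite -signr_odd -[in RHS]signr_odd; case: (odd e);
   rewrite ?expr0 ?expr1 ?mulN1r ?mul1r ?mcoeffN.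
Qed.

(** The Koszul differential preserves multidegrees, and a variable outside the support of [a]
    divides no monomial occurring there; so each strand is a subset complex on the support. *)
Lemma slice_koszul_diff r a b (f : {set 'I_n} -> 'rV[{mpoly K[n]}]_r) s :
  s \subset msupport a ->
  slice a b (koszul_diff f) s = subset_diff (msupport a) (slice a b f) s.
Proof.
move=> sa; rewrite /slice /koszul_diff /subset_diff summxE raddf_sum /=.
rewrite [LHS](bigID (mem (msupport a))) /= [X in _ + X]big1 ?addr0.
  apply: eq_big => j; first by rewrite !inE.
  move=> /andP[js]; rewrite inE => ja.
  rewrite mxE -mulrA mcoeff_ksignM mcoeff_mulXi mnmBE mesym1E (negPf js) subn0 ja.
  by rewrite mesym1U1 // submDA.
move=> j /andP[js]; rewrite inE negbK => /eqP ja.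
by rewrite mxE -mulrA mcoeff_ksignM mcoeff_mulXi mnmBE ja sub0n eqxx mulr0.
Qed.

Lemma sliceE r b (f : {set 'I_n} -> 'rV[{mpoly K[n]}]_r) s v :
  slice (v + mesym1 s)%MM b f s = (f s 0 b)@_v.
Proof. by rewrite /slice addmK. Qed.

Section Lift.
Variables (r : nat) (f : {set 'I_n} -> 'rV[{mpoly K[n]}]_r).
Variables (X : 'X_{1..n} -> pred {set 'I_n}) (t : 'X_{1..n} -> 'I_n).

Lemma htpy_neq0 v s b :
  subset_htpy (X (v + mesym1 s)%MM) (t (v + mesym1 s)%MM)
    (slice (v + mesym1 s)%MM b f) s != 0 ->
  exists2 l, l \in s & (v + U_(l))%MM \in msupp (f (s :\ l) 0 b).
Proof.
rewrite /subset_htpy; case: ifP => [/andP[]|_]; last by rewrite eqxx.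
move: (t _) => l ls _ h; exists l => //; rewrite mcoeff_msupp.
apply: contraNneq h; rewrite /slice.
have -> : (v + mesym1 s - mesym1 (s :\ l) = v + U_(l))%MM.
  by rewrite (mesym1D1 ls) [(_ + U_(_))%MM]addmC addmA addmK.
by move->; rewrite mulr0.
Qed.

(** The homotopies of the infinitely many strands glue to polynomials: a non-zero coefficient comes
    from a monomial of [f], which bounds the degree. The second conclusion keeps track of that
    monomial. *)
Lemma htpy_lift : exists g : {set 'I_n} -> 'rV[{mpoly K[n]}]_r,
  (forall a b s, s \subset msupport a ->
     slice a b g s = subset_htpy (X a) (t a) (slice a b f) s) /\
  (forall s b v, v \in msupp (g s 0 b) ->
     exists2 l, l \in s & (v + U_(l))%MM \in msupp (f (s :\ l) 0 b)).
Proof.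
pose d := (\max_s \max_b msize (f s 0%R b))%N.
pose E s b v := subset_htpy (X (v + mesym1 s)%MM) (t (v + mesym1 s)%MM)
    (slice (v + mesym1 s)%MM b f) s.
have dP s b v : E s b v != 0 -> (mdeg v < d)%N.
  move=> /htpy_neq0[l ls /msize_mdeg_lt]; rewrite mdegD mdeg1 addn1 => h.
  apply: leq_trans (ltnW h) _.
  apply: leq_trans (leq_bigmax (s :\ l)); exact: (leq_bigmax b).
pose g s : 'rV_r := \row_b \sum_(v : 'X_{1..n < d}) E s b v *: 'X_[v].
have gE s b v : (g s 0 b)@_v = E s b v.
  by rewrite mxE mcoeff_bounded_sum //; exact: dP.
exists g; split=> [a b s sa|s b v].
  by rewrite /slice gE /E submK // mesym1_le.
by rewrite mcoeff_msupp gE; apply: htpy_neq0.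
Qed.
End Lift.

(** A strand of non-zero multidegree is contracted by pairing [s :\ t] with [s] for some [t] in its
    support; the condition on constant terms settles multidegree 0. The control of supports serves
    to compute degrees. *)
Lemma koszul_exact r (f : {set 'I_n} -> 'rV[{mpoly K[n]}]_r) :
    (forall s, koszul_diff f s = 0) -> (forall b, (f set0 0 b)@_0 = 0) ->
  exists2 g, forall s, koszul_diff g s = f s &
    forall s b v, v \in msupp (g s 0 b) ->
     exists2 l, l \in s & (v + U_(l))%MM \in msupp (f (s :\ l) 0 b).
Proof.
move=> df f0.
(* Without variables there are only the cell [set0] and the monomial 1, where the condition on
   constant terms applies. *)
have [j0|n0] := pickP (fun _ : 'I_n => true); last first.
  exists (fun=> 0) => [s|s b v]; last by rewrite mxE msupp0.
  have -> : s = set0 by apply/setP=> j; have := n0 j.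
  rewrite /koszul_diff big1 => [|j]; last by have := n0 j.
  apply/rowP=> b; rewrite mxE; apply/mpolyP=> v.
  suff -> : v = 0%MM by rewrite mcoeff0 f0.
  by apply/mnmP=> j; have := n0 j.
pose t a := odflt j0 [pick j | a j != 0%N].
have [g [gE gS]] := htpy_lift f (fun=> predT) t.
exists g => // s; apply/rowP => b; apply/mpolyP => v.
rewrite -!(sliceE _ _ s v); set a := (v + mesym1 s)%MM.
have sa : s \subset msupport a by apply: msupport_addr.
rewrite slice_koszul_diff //.
rewrite (eq_subset_diff (c' := subset_htpy predT (t a) (slice a b f))); last first.
  move=> j; rewrite inE => /andP[_ ja]; apply: gE.
  by rewrite subUset sub1set ja.
have [j ja|a0] := pickP (fun j => a j != 0%N); last first.
  have ->: a = 0%MM.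
    by apply/mnmP=> j; rewrite mnm0E; have := a0 j; case: (a j).
  have -> : s = set0.
    apply/setP=> j; have := subsetP sa j; rewrite !inE (a0 j).
    by case: (j \in s) => // /(_ isT).
  rewrite /subset_diff big_pred0 => [|j]; last by rewrite !inE mnm0E.
  by rewrite /slice sub0m f0.
have ta : t a \in msupport a.
  by rewrite /t inE; case: pickP => //= /(_ j); rewrite ja.
have := @subset_retr_eq0 _ _ (msupport a) predT (t a) ta (fun _ _ _ _ => isT)
  (slice a b f) s isT.
rewrite /= andbF /subset_retr => /(_ isT) /eqP.
rewrite {2}/subset_htpy andbT; case: ifP => ts; last first.
  by rewrite subr0 subr_eq0 => /eqP.
rewrite -slice_koszul_diff; last by apply: subset_trans sa; apply: subD1set.
have -> : slice a b (koszul_diff f) (s :\ t a) = 0 by rewrite /slice df mxE mcoeff0.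
by rewrite mulr0 subr0 subr_eq0 => /eqP.
Qed.

End Koszul.

(** * Squarefree strongly stable ideals with squares *)

Section StableQuotient.
Local Open Scope ring_scope.
Variables (K : fieldType) (n : nat) (nr : pred {set 'I_n}) (j0 : 'I_n).
Hypothesis nr_down : forall P Q : {set 'I_n}, Q \subset P -> nr P -> nr Q.
Hypothesis nr_stable : forall (P : {set 'I_n}) (j t : 'I_n), (j < t)%N ->
  j \notin P -> t \notin P -> ~~ nr (t |: P) -> ~~ nr (j |: P).
Implicit Types (j t : 'I_n) (s T P : {set 'I_n}) (a u v : 'X_{1..n}).
Implicit Types f w : {set 'I_n} -> 'rV[{mpoly K[n]}]_1.

(* In multidegree a, the basis elements x^(a - s) e_s with a standard monomial. *)
Definition std a s := [exists P, nr P && (a == mesym1 P + mesym1 s)%MM].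

(** Criticality of x_P e_T in terms of P and T alone. The largest index of exponent 1 in x_P x_T is
    the largest element of the symmetric difference; it must lie in T and not be movable into P. For
    P = T all exponents are 2 and no index can be moved. *)
Definition crit P T := [&& nr P, T != set0 & (P == T) ||
  [exists t, [&& t \in T, t \notin P, ~~ nr (t |: P) &
     [forall j, ((j \in P) != (j \in T)) ==> (j <= t)%N]]]].

(** The pairing index. If no exponent equals 1, any index of the support serves; [j0] occurs only in
    multidegree 0. *)
Definition top a : 'I_n :=
  if [pick t | (a t == 1%N) && [forall j, (a j == 1%N) ==> (j <= t)%N]] is Some t
  then t else odflt j0 [pick j | a j != 0%N].

Definition nonstd (p : {mpoly K[n]}) := forall P, nr P -> p@_(mesym1 P) = 0.

Lemma stdE P s : std (mesym1 P + mesym1 s)%MM s = nr P.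
Proof.
apply/existsP/idP => [[Q /andP[nQ]]|nP]; last by exists P; rewrite nP eqxx.
by rewrite eqm_add2r => /eqP/inj_mesym1 ->.
Qed.

Lemma std_sub a s : std a s -> s \subset msupport a.
Proof. by case/existsP=> P /andP[_ /eqP->]; apply: msupport_addr. Qed.

Lemma mesym1DE P T j : (mesym1 P + mesym1 T)%MM j = ((j \in P) + (j \in T))%N.
Proof. by rewrite mnmDE !mesym1E. Qed.

Lemma std_up a s j : std a s -> j \in msupport a -> std a (j |: s).
Proof.
case/existsP=> P /andP[nP /eqP ->]; rewrite inE mesym1DE => jPs.
have [js|js] := boolP (j \in s).
  have -> : j |: s = s by apply/setUidPr; rewrite sub1set.
  by rewrite stdE.
have jP : j \in P by move: jPs; rewrite (negPf js) addn0; case: (j \in P).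
rewrite (mesym1D1 jP) -addmA [(U_(_) + _)%MM]addmC -mesym1U1 // stdE.
exact: nr_down (subD1set _ _) nP.
Qed.

Lemma std_D1 P T t : t \in T ->
  std (mesym1 P + mesym1 T)%MM (T :\ t) = (t \notin P) && nr (t |: P).
Proof.
move=> tT; rewrite (mesym1D1 tT) [(mesym1 (T :\ t) + _)%MM]addmC addmA.
have [tP|tP] /= := boolP (t \in P); last by rewrite -mesym1U1 // stdE.
apply/negbTE/negP => /existsP[Q /andP[_]]; rewrite eqm_add2r => /eqP/mnmP/(_ t).
by rewrite mnmDE !mesym1E mnm1E eqxx tP; case: (t \in Q).
Qed.

Lemma addb1 (b c : bool) : ((b + c)%N == 1%N) = (b != c).
Proof. by case: b; case: c. Qed.

Lemma top1 a : (exists j, a j = 1%N) ->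
  a (top a) = 1%N /\ forall j, a j = 1%N -> (j <= top a)%N.
Proof.
case=> j /eqP aj; rewrite /top; case: pickP => [t /= /andP[/eqP at1 /forallP h]|h].
  by split=> // l /eqP al; have := h l; rewrite al.
have := h [arg max_(i > j | a i == 1%N) (i : nat)].
case: arg_maxnP => // i ai hi; rewrite ai /= => /negbT/forallP[] l.
by apply/implyP=> /hi.
Qed.

Lemma top_mem a s : s != set0 -> s \subset msupport a -> top a \in msupport a.
Proof.
case/set0Pn=> j js /subsetP/(_ j js); rewrite !inE /top => aj.
case: pickP => [t /andP[/eqP-> _]|_] //=.
by case: pickP => //= /(_ j); rewrite aj.
Qed.

Lemma critE P T : T != set0 ->
  critical (std (mesym1 P + mesym1 T)%MM) (top (mesym1 P + mesym1 T)%MM) T =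
  crit P T.
Proof.
move=> T0; rewrite /critical /crit stdE T0 /=; case: (boolP (nr P)) => //= nP.
set a := (_ + _)%MM.
have ta := @top_mem a T T0 (msupport_addr _ _).
have [PT|PT] /= := eqVneq P T.
  have tT : top a \in T by move: ta; rewrite inE mesym1DE PT; case: (_ \in _).
  by rewrite tT std_D1 // PT tT.
have ex1 : exists j, a j = 1%N.
  suff [j h] : exists j, (j \in P) != (j \in T).
    by exists j; apply/eqP; rewrite mesym1DE addb1.
  apply/existsP; apply: contra_neqT PT; rewrite negb_exists => /forallP h.
  by apply/setP=> j; apply/eqP; have := h j; rewrite negbK.
have [at1 amax] := top1 ex1.
have tPT : (top a \in P) != (top a \in T) by rewrite -addb1 -mesym1DE at1.
apply/andP/existsP => [[tT]|[t /and4P[tT tP ntP /forallP tmax]]].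
  rewrite std_D1 //; move: tPT; rewrite tT => tP.
  have {}tP : top a \notin P by move: tP; case: (_ \in P).
  rewrite tP => /= ntP; exists (top a); rewrite tT tP ntP /=.
  apply/forallP => j; apply/implyP => h; apply: amax.
  by apply/eqP; rewrite mesym1DE addb1.
have -> : top a = t.
  apply/val_inj/eqP; rewrite eqn_leq (implyP (tmax _) tPT) amax //.
  by rewrite mesym1DE tT (negPf tP).
by rewrite tT std_D1 // tP.
Qed.

(** An index of T outside P is at most the [t] of the definition. Since [t] cannot be added to P,
    strong stability excludes every smaller index as well. *)
Lemma crit_min P T j : crit P T -> j \in T ->
  ~~ std (mesym1 P + mesym1 T)%MM (T :\ j).
Proof.
case/and3P => nP T0 h jT; rewrite std_D1 // negb_and negbK.
have [//|jP] /= := boolP (j \in P); case/orP: h => [/eqP PT|].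
  by rewrite PT jT in jP.
case/existsP => t /and4P[tT tP ntP /forallP/(_ j)].
rewrite jT (negPf jP) /= leq_eqVlt => /orP[/eqP/val_inj->//|jt].
exact: nr_stable ntP.
Qed.

Lemma critical_std a s : critical (std a) (top a) s ->
  exists2 P, crit P s & a = (mesym1 P + mesym1 s)%MM.
Proof.
move=> c; have /and3P[/existsP[P /andP[nP /eqP E]] ts _] := c.
exists P => //; rewrite -critE -?E //.
by apply/set0Pn; exists (top a).
Qed.

Lemma critical_std_min a s j : critical (std a) (top a) s -> j \in s ->
  ~~ std a (s :\ j).
Proof. by case/critical_std => P c ->; apply: crit_min. Qed.

(** The functional attached to a critical cell: the value at T of id - dh - hd, where hd contributes
    nothing because T is critical. *)
Definition crit_coef f P T : K :=
  let a := (mesym1 P + mesym1 T)%MM in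
  slice a 0 f T -
    subset_diff (msupport a) (subset_htpy (std a) (top a) (slice a 0 f)) T.

Lemma slice_nonstd f a s : nonstd (f s 0 0) -> std a s -> slice a 0 f s = 0.
Proof. by move=> h /existsP[P /andP[nP /eqP->]]; rewrite /slice addmK h. Qed.

Lemma slice_linear (c : K) f g a s :
  slice a 0 (fun s => c%:MP *: f s + g s) s = c * slice a 0 f s + slice a 0 g s.
Proof. by rewrite /slice !mxE mcoeffD mcoeffCM. Qed.

Lemma crit_coef_linear (c : K) f g P T :
  crit_coef (fun s => c%:MP *: f s + g s) P T = c * crit_coef f P T + crit_coef g P T.
Proof.
rewrite /crit_coef; set a := (_ + _)%MM.
have -> : subset_diff (msupport a) (subset_htpy (std a) (top a)
     (slice a 0 (fun s => c%:MP *: f s + g s))) T =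
  c * subset_diff (msupport a) (subset_htpy (std a) (top a) (slice a 0 f)) T +
  subset_diff (msupport a) (subset_htpy (std a) (top a) (slice a 0 g)) T.
  rewrite /subset_diff mulr_sumr -big_split /=; apply: eq_bigr => j _.
  rewrite /subset_htpy slice_linear; case: ifP => _; last by rewrite !mulr0 addr0.
  by rewrite !mulrDr; congr (_ + _); rewrite !(mulrCA _ c).
by rewrite slice_linear mulrBr opprD addrACA.
Qed.

Lemma eq_crit_coef f g P T : f =1 g -> crit_coef f P T = crit_coef g P T.
Proof.
move=> fg; rewrite /crit_coef /slice fg; congr (_ - _).
by apply: eq_bigr => j _; rewrite /subset_htpy fg.
Qed.

Lemma crit_coef_nonstd f P T : (forall s, nonstd (f s 0 0)) -> nr P ->
  crit_coef f P T = 0.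
Proof.
move=> hf nP; rewrite /crit_coef slice_nonstd ?stdE // sub0r.
rewrite /subset_diff big1 ?oppr0 // => j _; rewrite /subset_htpy.
by case: ifP => [/andP[_ h]|_]; rewrite ?slice_nonstd ?mulr0.
Qed.

Lemma crit_coef_diff f P T : crit P T -> crit_coef (koszul_diff f) P T = 0.
Proof.
move=> c; have /and3P[nP T0 _] := c; rewrite /crit_coef; set a := (_ + _)%MM.
have Ta : T \subset msupport a := msupport_addr _ _.
have ta := top_mem T0 Ta.
rewrite slice_koszul_diff //.
have -> : subset_diff (msupport a)
    (subset_htpy (std a) (top a) (slice a 0 (koszul_diff f))) T =
  subset_diff (msupport a) (subset_htpy (std a) (top a)
    (subset_diff (msupport a) (slice a 0 f))) T.
  apply: eq_subset_diff => j _; rewrite /subset_htpy.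
  by case: ifP => // /andP[_ /std_sub h]; rewrite slice_koszul_diff.
apply: subset_retr_diff => //; first exact: std_up.
  exact: critical_std_min.
by rewrite critE.
Qed.

(** Needed for comparing degrees: the functional reads only terms of [f] of the same multidegree and
    the same homological degree. *)
Lemma crit_coef_support f P T : crit_coef f P T != 0 ->
  exists2 s : {set 'I_n}, #|s| = #|T| & exists2 u, u \in msupp (f s 0 0) &
    (u + mesym1 s = mesym1 P + mesym1 T)%MM.
Proof.
rewrite /crit_coef; set a := (_ + _)%MM => h.
have sliceP s : s \subset msupport a -> slice a 0 f s != 0 ->
    exists2 u, u \in msupp (f s 0 0) & (u + mesym1 s = a)%MM.
  move=> sa; rewrite /slice -mcoeff_msupp => us.
  by exists (a - mesym1 s)%MM; rewrite // submK // mesym1_le.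
have Ta : T \subset msupport a := msupport_addr _ _.
have [sT|sT] := eqVneq (slice a 0 f T) 0; last first.
  by exists T => //; apply: sliceP.
move: h; rewrite sT sub0r oppr_eq0 => h.
have [j] : exists j, (j \in msupport a :\: T) &&
    (subset_htpy (std a) (top a) (slice a 0 f) (j |: T) != 0).
  apply/existsP; apply: contraNT h; rewrite negb_exists => /forallP h.
  rewrite /subset_diff big1 // => j ja.
  by have := h j; rewrite ja negbK /= => /eqP->; rewrite mulr0.
rewrite inE -andbA => /and3P[jT ja]; rewrite /subset_htpy.
case: ifP => [/andP[tj _]|_]; last by rewrite eqxx.
rewrite mulf_eq0 negb_or => /andP[_ h']; exists ((j |: T) :\ top a).
  by have := cardsD1 (top a) (j |: T); rewrite tj cardsU1 jT !add1n => -[].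
apply: sliceP => //; apply: subset_trans (subD1set _ _) _.
by rewrite subUset sub1set ja.
Qed.

(** The functionals detect homology. On a cycle the term hdf vanishes, so f = dhf at every
    non-critical cell, while at critical cells this equality is the vanishing of the functional. The
    condition at [set0] covers multidegree 0, where there is nothing to pair with. *)
Lemma crit_coef_cycle f : f set0 = 0 ->
    (forall s, nonstd (koszul_diff f s 0 0)) ->
    (forall P T, crit P T -> crit_coef f P T = 0) ->
  exists g, forall s, nonstd ((f s - koszul_diff g s) 0 0).
Proof.
move=> f0 cyc coef0; have [g [gE _]] := htpy_lift f std top.
exists g => s P nP; rewrite 2!mxE mcoeffB -!sliceE; set a := (_ + _)%MM.
have sa : s \subset msupport a := msupport_addr _ _.
rewrite slice_koszul_diff //.
rewrite (eq_subset_diff (c' := subset_htpy (std a) (top a) (slice a 0 f))); last first.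
  move=> j; rewrite inE => /andP[_ ja]; apply: gE.
  by rewrite subUset sub1set ja.
have Xs : std a s by rewrite stdE.
have [a0|] := eqVneq (msupport a) set0.
  rewrite /subset_diff a0 set0D big_set0 subr0.
  by move: sa; rewrite a0 subset0 /slice => /eqP->; rewrite f0 mxE mcoeff0.
move=> /top_mem /(_ (subxx _)) ta.
have [cs|ncs] := boolP (critical (std a) (top a) s).
  have s0 : s != set0 by apply/set0Pn; exists (top a); case/and3P: cs.
  by apply: coef0; rewrite -critE.
have := subset_retr_eq0 ta (@std_up a) (slice a 0 f) Xs.
rewrite /critical Xs in ncs; move/(_ ncs); rewrite /subset_retr.
suff -> : subset_htpy (std a) (top a) (subset_diff (msupport a) (slice a 0 f)) s = 0.
  by rewrite subr0.
rewrite /subset_htpy; case: ifP => // /andP[_ h].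
by rewrite -slice_koszul_diff ?std_sub // slice_nonstd ?mulr0.
Qed.

Definition crit_cell P T s : 'rV[{mpoly K[n]}]_1 :=
  if s == T then const_mx 'X_[mesym1 P] else 0.

Lemma slice_crit_cell P T a s : s \subset msupport a ->
  slice a 0 (crit_cell P T) s = ((s == T) && (a == mesym1 P + mesym1 T)%MM)%:R.
Proof.
rewrite -mesym1_le /slice /crit_cell => sa.
case: eqP sa => [-> sa|_]; last by rewrite mxE mcoeff0.
rewrite mxE mcoeffX; congr (nat_of_bool _)%:R.
by rewrite -(eqm_add2r (mesym1 T)) submK // eq_sym.
Qed.

(** Each term of the boundary deletes some j from T and multiplies x_P by x_j, which by [crit_min]
    yields a nonstandard monomial. *)
Lemma crit_cell_cycle P T : crit P T ->
  forall s, nonstd (koszul_diff (crit_cell P T) s 0 0).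
Proof.
move=> c s Q nQ; rewrite -sliceE; set a := (_ + _)%MM.
have sa : s \subset msupport a := msupport_addr _ _.
rewrite slice_koszul_diff // /subset_diff big1 // => j; rewrite inE => /andP[js ja].
rewrite slice_crit_cell ?subUset ?sub1set ?ja //.
case: andP => [[/eqP jsT /eqP E]|_]; last by rewrite mulr0.
have jT : j \in T by rewrite -jsT setU11.
have := crit_min c jT; rewrite -E -jsT setU1K // stdE nQ //.
Qed.

(** Critical cells and their functionals are dual: the correction dh reads a chain only on sets that
    omit the pairing index, whereas T contains it. *)
Lemma crit_coef_cell P T P' T' : crit P T ->
  crit_coef (crit_cell P T) P' T' = ((P' == P) && (T' == T))%:R.
Proof.
move=> c; rewrite /crit_coef; set a := (_ + _)%MM.
have sa : T' \subset msupport a := msupport_addr _ _.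
rewrite slice_crit_cell // /subset_diff big1 ?subr0 => [|j].
  rewrite andbC /a; case: (eqVneq T' T) => [->|]; last by rewrite !andbF.
  by rewrite !andbT eqm_add2r (inj_eq (@inj_mesym1 n)).
rewrite inE => /andP[_ ja]; rewrite /subset_htpy.
case: ifP => [_|_]; last by rewrite mulr0.
rewrite slice_crit_cell; last first.
  apply: subset_trans (subD1set _ _) _; by rewrite subUset sub1set ja.
case: andP => [[/eqP jT /eqP E]|_]; last by rewrite !mulr0.
have T0 : T != set0 by case/and3P: c.
have := c; rewrite -critE // -E => /and3P[_].
by rewrite -{1}jT !inE eqxx.
Qed.

End StableQuotient.

(** * Dimension shifting *)

Section DimensionShift.
Local Open Scope ring_scope.
Variables (K : fieldType) (n : nat).
Local Notation S := {mpoly K[n]}.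
Implicit Types (j t : 'I_n) (s : {set 'I_n}).

Lemma koszul_diffB r (f g : {set 'I_n} -> 'rV[S]_r) s :
  koszul_diff (fun s => f s - g s) s = koszul_diff f s - koszul_diff g s.
Proof. by rewrite /koszul_diff -sumrB; apply: eq_bigr => j _; rewrite scalerBr. Qed.

Lemma koszul_diff_sum (A : finType) r (c : A -> S) (y : A -> {set 'I_n} -> 'rV[S]_r) s :
  koszul_diff (fun s => \sum_a c a *: y a s) s = \sum_a c a *: koszul_diff (y a) s.
Proof.
rewrite /koszul_diff (eq_bigr _ (fun j _ => scaler_sumr _ _ _ _)) exchange_big /=.
apply: eq_bigr => a _; rewrite scaler_sumr; apply: eq_bigr => j _.
by rewrite !scalerA mulrC.
Qed.

Lemma koszul_diffM r' r (D : 'M[S]_(r', r)) (f : {set 'I_n} -> 'rV[S]_r') s :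
  koszul_diff (fun s => f s *m D) s = koszul_diff f s *m D.
Proof.
by rewrite /koszul_diff mulmx_suml; apply: eq_bigr => j _; rewrite -scalemxAl.
Qed.

Lemma eq_koszul_diff r (f g : {set 'I_n} -> 'rV[S]_r) s :
  f =1 g -> koszul_diff f s = koszul_diff g s.
Proof. by move=> fg; apply: eq_bigr => j _; rewrite fg. Qed.

Lemma koszul_diffK r (f : {set 'I_n} -> 'rV[S]_r) s :
  koszul_diff (koszul_diff f) s = 0.
Proof.
apply/rowP => b; rewrite [RHS]mxE; apply/mpolyP => v; rewrite mcoeff0 -sliceE.
set a := (v + _)%MM; have sa : s \subset msupport a := msupport_addr _ _.
rewrite slice_koszul_diff // -[RHS](subset_diffK (msupport a) (slice a b f) s).
apply: eq_subset_diff => j; rewrite inE => /andP[_ ja].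
by rewrite slice_koszul_diff // subUset sub1set ja.
Qed.

Lemma koszul_diff_supp0 r (f : {set 'I_n} -> 'rV[S]_r) q :
  (forall s, #|s| != q.+1 -> f s = 0) ->
  forall s, #|s| != q -> koszul_diff f s = 0.
Proof.
move=> f0 s sq; apply: big1 => j js; rewrite f0 ?scaler0 //.
by rewrite cardsU1 js.
Qed.

Definition in_rows r' r (D : 'M[S]_(r', r)) (v : 'rV[S]_r) := exists w, v = w *m D.

Definition irrelevant r' r (D : 'M[S]_(r', r)) := forall a b, (D a b)@_0 = 0.

Lemma mul_irrelevant r' r (D : 'M[S]_(r', r)) (v : 'rV_r') b :
  irrelevant D -> ((v *m D) 0 b)@_0 = 0.
Proof.
move=> D0; rewrite mxE raddf_sum /= big1 // => c _.
have /= -> := rmorphM (@mcoeff n K 0%MM) (v 0 c) (D c b).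
by rewrite D0 mulr0.
Qed.

(* The classes of the cycles y a form a basis, with degrees deg, of the q-th
   Koszul homology of the cokernel of D; a cycle of the cokernel is a chain of the
   free module whose differential lies in the row space of D. *)
Record koszul_basis r' r (D : 'M[S]_(r', r)) (dg : 'I_r -> nat) q m
    (deg : 'I_m -> nat) (y : 'I_m -> {set 'I_n} -> 'rV[S]_r) : Prop := KoszulBasis {
  kb_supp : forall a s, #|s| != q -> y a s = 0;
  kb_cycle : forall a s, in_rows D (koszul_diff (y a) s);
  kb_deg : forall a s b u, u \in msupp (y a s 0 b) ->
    (mdeg u + #|s| + dg b)%N = deg a;
  kb_span : forall w, (forall s, #|s| != q -> w s = 0) ->
    (forall s, in_rows D (koszul_diff w s)) ->
    exists (c : 'I_m -> K) u, forall s,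
      in_rows D (w s - \sum_a (c a)%:MP *: y a s - koszul_diff u s);
  kb_free : forall (c : 'I_m -> K) u,
    (forall s, in_rows D (\sum_a (c a)%:MP *: y a s - koszul_diff u s)) ->
    forall a, c a = 0
}.

Lemma koszul_diff_set0_const r (u : {set 'I_n} -> 'rV[S]_r) b :
  (koszul_diff u set0 0 b)@_0 = 0.
Proof.
have := sliceE b (koszul_diff u) set0 0%MM; rewrite mesym1_set0 addm0 => <-.
rewrite slice_koszul_diff ?sub0set // /subset_diff big_pred0 // => j.
by rewrite !inE mnm0E.
Qed.

(** The zeroth Koszul homology of the cokernel is its reduction modulo the variables. Since D has no
    constant terms, the generators remain independent there. *)
Lemma koszul_basis0 r' r (D : 'M[S]_(r', r)) dg : irrelevant D ->
  koszul_basis D dg 0 dg (fun a s => if s == set0 then delta_mx 0 a else 0).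
Proof.
move=> D0; have deltaE (c : 'I_r -> K) b :
    (\sum_a (c a)%:MP *: (delta_mx 0 a : 'rV[S]_r)) 0 b = (c b)%:MP.
  rewrite summxE (bigD1 b) //= !mxE !eqxx mulr1 big1 ?addr0 // => a ab.
  by rewrite !mxE eqxx /= eq_sym (negPf ab) mulr0.
split.
- by move=> a s; rewrite cards_eq0 => /negPf->.
- move=> a s; exists 0; rewrite mul0mx; apply: big1 => j js.
  by rewrite -cards_eq0 cardsU1 js scaler0.
- move=> a s b u; case: eqP => [->|_]; last by rewrite mxE msupp0.
  rewrite mxE eqxx /= cards0 addn0; case: eqP => [->|_]; last by rewrite msupp0.
  by rewrite msupp1 inE => /eqP->; rewrite mdeg0.
- move=> w w0 _; pose c a := (w set0 0 a)@_0.
  pose h s := w s - \sum_a (c a)%:MP *: (if s == set0 then delta_mx 0 a else 0).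
  have h0 s : s != set0 -> h s = 0.
    move=> s0; rewrite /h w0 ?cards_eq0 // big1 ?subrr // => a _.
    by rewrite (negPf s0) scaler0.
  have [s|b|g gE _] := @koszul_exact K n r h.
  + apply: big1 => j js; rewrite h0 ?scaler0 //.
    by rewrite -cards_eq0 cardsU1 js.
  + by rewrite /h eqxx 2!mxE mcoeffB deltaE mcoeffC eqxx mulr1 subrr.
  exists c, g => s; exists 0; rewrite mul0mx gE; apply/eqP.
  by rewrite subr_eq0.
- move=> c u h b; have [w E] := h set0; rewrite eqxx in E.
  have := mul_irrelevant w b D0; rewrite -E 2!mxE mcoeffB deltaE.
  by rewrite koszul_diff_set0_const subr0 mcoeffC eqxx mulr1.
Qed.

Lemma msupp_mulmx r' r (v : 'rV[S]_r') (D : 'M[S]_(r', r)) b u :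
  u \in msupp ((v *m D) 0 b) ->
  exists c u1 u2, [/\ u1 \in msupp (v 0 c), u2 \in msupp (D c b) & u = (u1 + u2)%MM].
Proof.
rewrite mxE => /msupp_sum_le /flattenP[_ /mapP[c _ ->]].
by move/msuppM_le/allpairsP => [[u1 u2] /= [h1 h2 ->]]; exists c, u1, u2.
Qed.

(** The connecting map of 0 -> coker D' -> S^r -> coker D -> 0 is an isomorphism, because the Koszul
    complex of S^r is exact in positive degrees and D is zero modulo the variables. The new cycle
    [y a] is a Koszul preimage of [y' a *m D]. *)
Lemma koszul_basisS r'' r' r (D' : 'M[S]_(r'', r')) (D : 'M[S]_(r', r))
    (dg' : 'I_r' -> nat) (dg : 'I_r -> nat) q m (deg : 'I_m -> nat) y' :
  (forall v, v *m D = 0 <-> in_rows D' v) -> irrelevant D ->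
  (forall a b u, u \in msupp (D a b) -> (mdeg u + dg b)%N = dg' a) ->
  koszul_basis D' dg' q deg y' -> exists y, koszul_basis D dg q.+1 deg y.
Proof.
move=> ex D0 Ddeg [supp' cyc' deg' span' free'].
have /fin_all_exists2[y yE yS] a : exists2 g : {set 'I_n} -> 'rV[S]_r,
    (forall s, koszul_diff g s = y' a s *m D) &
    forall s b v, v \in msupp (g s 0 b) -> exists2 l, l \in s &
      (v + U_(l))%MM \in msupp ((y' a (s :\ l) *m D) 0 b).
  apply: (@koszul_exact K n r (fun s => y' a s *m D)) => [s|b].
    by rewrite koszul_diffM; apply/ex/cyc'.
  exact: mul_irrelevant.
have ysupp a s : #|s| != q.+1 -> y a s = 0.
  move=> sq; apply/rowP => b; rewrite mxE; apply/eqP; rewrite -msupp_eq0.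
  case E: msupp => [//|v vs]; have /yS[l ls] : v \in msupp (y a s 0 b).
    by rewrite E mem_head.
  rewrite supp' ?mul0mx ?mxE ?msupp0 //.
  by apply: contra sq; rewrite (cardsD1 l s) ls => /eqP->.
have ySumE c s : koszul_diff (fun s => \sum_a c a *: y a s) s =
    (\sum_a c a *: y' a s) *m D.
  rewrite koszul_diff_sum mulmx_suml; apply: eq_bigr => a _.
  by rewrite yE scalemxAl.
exists y; split=> //.
- by move=> a s; rewrite yE; exists (y' a s).
- move=> a s b v /yS[l ls] /msupp_mulmx[c [u1 [u2 [h1 h2 E]]]].
  have := deg' _ _ _ _ h1; have := Ddeg _ _ _ h2.
  have := congr1 mdeg E; rewrite !mdegD mdeg1 (cardsD1 l s) ls; lia.
- move=> w w0 /fin_all_exists[z0 z0E].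
  (* The preimages are chosen set by set, so they must be cut down to homological degree q. *)
  pose z s := if #|s| == q then z0 s else 0.
  have zE s : koszul_diff w s = z s *m D.
    rewrite /z; case: eqP => [_|/eqP sq]; first exact: z0E.
    by rewrite mul0mx; apply: koszul_diff_supp0 sq.
  have [s|s|c [u zcu]] := span' z.
  + by rewrite /z => /negPf->.
  + by apply/ex; rewrite -koszul_diffM -(eq_koszul_diff _ zE) koszul_diffK.
  (* After correction by rows of D, the difference is a genuine Koszul cycle over S, hence a
     boundary. *)
  pose h s := w s - \sum_a (c a)%:MP *: y a s - u s *m D.
  have [s|b|g gE _] := @koszul_exact K n r h.
  + rewrite /h koszul_diffB koszul_diffB koszul_diffM zE ySumE -!mulmxBl.
    exact/ex/zcu.
  + rewrite /h w0 ?cards0 // big1 => [|a _]; last by rewrite ysupp ?cards0 ?scaler0.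
    by rewrite !sub0r oppr0 add0r mxE mcoeffN mul_irrelevant // oppr0.
  exists c, g => s; exists (u s); rewrite gE /h.
  by rewrite opprB addrCA subrr addr0.
- move=> c u /fin_all_exists[v vE]; apply: (free' c v) => s; apply/ex.
  rewrite mulmxBl -ySumE -koszul_diffM -(eq_koszul_diff _ vE) koszul_diffB.
  by rewrite koszul_diffK subr0 subrr.
Qed.

End DimensionShift.

(** * Koszul homology read off a minimal resolution *)

Section Resolution.
Local Open Scope ring_scope.
Variables (K : fieldType) (n : nat) (I : {mpoly K[n]} -> Prop).
Variable F : min_graded_free_res I.
Hypothesis I0 : forall p, I p -> p@_0 = 0.

(** The resolution of I is prolonged by S in position 0 to one of S/I, so F_i sits in position i +
    1. *)
Definition aug_rank p := if p is p'.+1 then mgfr_rank F p' else 1%N.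
Definition aug_deg p : 'I_(aug_rank p) -> nat :=
  if p is p'.+1 return 'I_(aug_rank p) -> nat then @mgfr_deg _ _ _ F p' else fun=> 0%N.
Definition aug_diff p : 'M[{mpoly K[n]}]_(aug_rank p.+1, aug_rank p) :=
  if p is p'.+1 return 'M[{mpoly K[n]}]_(aug_rank p.+1, aug_rank p)
  then mgfr_diff F p' else mgfr_aug F.

Lemma aug_diff_irrelevant p : irrelevant (aug_diff p).
Proof.
case: p => [|p] a b; last exact: mgfr_minimal.
rewrite ord1; apply/I0/mgfr_aug_image; exists (delta_mx 0 a).
by rewrite -rowE mxE.
Qed.

Lemma aug_diff_exact p v : v *m aug_diff p = 0 <-> in_rows (aug_diff p.+1) v.
Proof. by case: p v => [|p] v; [apply: mgfr_aug_exact | apply: mgfr_diff_exact]. Qed.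

Lemma aug_diff_deg p a b u : u \in msupp (aug_diff p a b) ->
  (mdeg u + aug_deg b)%N = aug_deg a.
Proof.
case: p a b => [|p] a b; last by move=> /mgfr_diff_homog.
by rewrite ord1 addn0 => h; have /dhomogP/(_ _ h) := mgfr_aug_homog a.
Qed.

(** The cokernel in position i + 1 has the generators of F_i as basis of H_0. Each shift lowers the
    position by one and raises the homological degree by one, ending with H_(i+1) of S/I. *)
Lemma mgfr_koszul_basis i : exists y,
  koszul_basis (mgfr_aug F) (fun=> 0%N) i.+1 (@mgfr_deg _ _ _ F i) y.
Proof.
suff h q p : (q + p)%N = i.+1 -> exists y,
    koszul_basis (aug_diff p) (@aug_deg p) q (@mgfr_deg _ _ _ F i) y.
  by apply: (h i.+1 0%N); rewrite addn0.
elim: q p => [|q IH] p.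
  rewrite add0n => ->; eexists.
  exact: koszul_basis0 (@aug_diff_irrelevant i.+1).
rewrite addSnnS => /IH[y]; apply: koszul_basisS.
- exact: aug_diff_exact.
- exact: aug_diff_irrelevant.
- exact: aug_diff_deg.
Qed.

End Resolution.

(** * Betti numbers by critical cells *)

Section CritBetti.
Local Open Scope ring_scope.

(** M is block diagonal with respect to the degrees. Each block inherits independence of rows and
    surjectivity, hence is square. *)
Lemma graded_card_eq (K : fieldType) (A B : finType) (pB : pred B)
    (dA : A -> nat) (dB : B -> nat) (M : A -> B -> K) :
    (forall a b, pB b -> M a b != 0 -> dA a = dB b) ->
    (forall c : A -> K, (forall b, pB b -> \sum_a c a * M a b = 0) ->
      forall a, c a = 0) ->
    (forall g : B -> K, exists c : A -> K, forall b, pB b ->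
      \sum_a c a * M a b = g b) ->
  forall j, #|[set a | dA a == j]| = #|[set b | pB b && (dB b == j)]|.
Proof.
move=> Mdeg Mfree Mspan j.
set A1 := [set a | _]; set B1 := [set b | _].
pose N := \matrix_(i < #|A1|, l < #|B1|) M (enum_val i) (enum_val l).
apply/eqP; rewrite eqn_leq; apply/andP; split.
  suff /eqP <- : row_free N by apply: rank_leq_col.
  apply: inj_row_free => v vN.
  pose c a := \sum_i v 0 i * (enum_val i == a)%:R.
  have cE b : \sum_a c a * M a b = \sum_i v 0 i * M (enum_val i) b.
    under eq_bigr => a _ do rewrite mulr_suml.
    rewrite exchange_big /=; apply: eq_bigr => i _.
    rewrite (bigD1 (enum_val i)) //= eqxx mulr1 big1 ?addr0 // => a ai.
    by rewrite eq_sym (negPf ai) mulr0 mul0r.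
  have c0 a : c a = 0.
    apply: Mfree => b pb; rewrite cE.
    have [bj|bj] := eqVneq (dB b) j; last first.
      rewrite big1 // => i _; case: (eqVneq (M (enum_val i) b) 0) => [->|].
        by rewrite mulr0.
      move/(Mdeg _ _ pb) => h; case/eqP: bj; rewrite -h.
      by have := enum_valP i; rewrite inE => /eqP.
    have bB : b \in B1 by rewrite inE pb bj eqxx.
    move/rowP/(_ (enum_rank_in bB b)): vN; rewrite !mxE => N0; rewrite -[RHS]N0.
    by apply: eq_bigr => i _; rewrite mxE enum_rankK_in.
  apply/rowP => i; rewrite mxE -(c0 (enum_val i)) /c (bigD1 i) //= eqxx mulr1.
  rewrite big1 ?addr0 // => l li.
  by rewrite (inj_eq enum_val_inj) (negPf li) mulr0.
suff /eqP <- : row_full N by apply: rank_leq_row.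
apply/row_fullP.
have /fin_all_exists[c cE] (b0 : B) : exists c : A -> K, forall b, pB b ->
    \sum_a c a * M a b = (b == b0)%:R by apply: Mspan.
exists (\matrix_(l, i) c (enum_val l) (enum_val i)).
apply/matrixP => l l'; rewrite !mxE.
have := enum_valP l'; rewrite inE => /andP[pb /eqP bj].
rewrite -(inj_eq enum_val_inj) eq_sym -(cE _ _ pb).
rewrite (bigID (mem A1)) /= [X in _ = _ + X]big1 ?addr0.
  by rewrite [RHS]big_enum_val; apply: eq_bigr => i _; rewrite !mxE.
move=> a; rewrite inE => aj.
case: (eqVneq (M a (enum_val l')) 0) => [->|]; first by rewrite mulr0.
by move/(Mdeg _ _ pb); rewrite bj => /eqP; rewrite (negPf aj).
Qed.

Variables (K : fieldType) (n : nat) (nr : pred {set 'I_n}) (j0 : 'I_n).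
Hypothesis nr_down : forall P Q : {set 'I_n}, Q \subset P -> nr P -> nr Q.
Hypothesis nr_stable : forall (P : {set 'I_n}) (j t : 'I_n), (j < t)%N ->
  j \notin P -> t \notin P -> ~~ nr (t |: P) -> ~~ nr (j |: P).
Hypothesis nr0 : nr set0.
Variables (I : {mpoly K[n]} -> Prop) (F : min_graded_free_res I).
Hypothesis I_nonstd : forall p, I p <-> nonstd nr p.

Lemma crit_coef_sum (T0 : finType) (c : T0 -> K) (y : T0 -> {set 'I_n} -> 'rV[{mpoly K[n]}]_1) P T :
  crit_coef nr j0 (fun s => \sum_a (c a)%:MP *: y a s) P T =
  \sum_a c a * crit_coef nr j0 (y a) P T.
Proof.
elim: (index_enum _) => [|a r IH].
  rewrite (@eq_crit_coef _ _ _ _ _ (fun s => 0)); last by move=> s; rewrite big_nil.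
  rewrite big_nil /crit_coef /slice mxE mcoeff0 sub0r.
  rewrite /subset_diff big1 ?oppr0 // => j _; rewrite /subset_htpy /=. rewrite mcoeff0.
  by rewrite mulr0 if_same mulr0.
rewrite (@eq_crit_coef _ _ _ _ _ (fun s => (c a)%:MP *: y a s + \sum_(a <- r) (c a)%:MP *: y a s));
  last by move=> s; rewrite big_cons.
by rewrite crit_coef_linear big_cons IH.
Qed.

Lemma in_rows_aug v : in_rows (mgfr_aug F) v <-> nonstd nr (v 0 0).
Proof.
rewrite -I_nonstd; split=> [[w ->]|/(mgfr_aug_image F)[w E]].
  by apply: (mgfr_aug_image F _).2; exists w.
by exists w; apply/matrixP => x y; rewrite !ord1.
Qed.

(** The matrix of critical functionals on the classes [y a] is invertible: a cycle on which they all
    vanish is a boundary, and the critical cells realize arbitrary values. The shift [i.+1] appears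
    because F resolves I and not S/I. *)
Theorem betti_crit i j : graded_betti F i j =
  #|[set c : {set 'I_n} * {set 'I_n} |
     [&& crit nr c.1 c.2, #|c.2| == i.+1 & #|c.1| + #|c.2| == j]%N]|.
Proof.
have [|y [ysupp ycyc ydeg yspan yfree]] := @mgfr_koszul_basis _ _ _ F _ i.
  by move=> p /I_nonstd /(_ _ nr0); rewrite mesym1_set0.
rewrite /graded_betti.
rewrite (@graded_card_eq K _ _
  (fun c : {set 'I_n} * {set 'I_n} => crit nr c.1 c.2 && (#|c.2| == i.+1))
  (@mgfr_deg _ _ _ F i) (fun c => #|c.1| + #|c.2|)%N
  (fun a c => crit_coef nr j0 (y a) c.1 c.2)).
- by apply: eq_card => c; rewrite !inE andbA.
- move=> a [P T] /= /andP[cr /eqP qT] /crit_coef_support[s sT [u us E]].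
  rewrite -(ydeg a s 0 u us) addn0 -!mdeg_mesym1 -!mdegD; congr mdeg.
  by rewrite E.
- move=> c c0.
  pose w s := \sum_a (c a)%:MP *: y a s.
  have wc s : nonstd nr (koszul_diff w s 0 0).
    apply/in_rows_aug; rewrite koszul_diff_sum.
    have /fin_all_exists[v vE] a : in_rows (mgfr_aug F) (koszul_diff (y a) s).
      exact: ycyc.
    exists (\sum_a (c a)%:MP *: v a); rewrite mulmx_suml.
    by apply: eq_bigr => a _; rewrite -scalemxAl vE.
  have [|P T cr|u uE] := @crit_coef_cycle K n nr j0 nr_down w _ wc.
  + by rewrite /w big1 // => a _; rewrite ysupp ?cards0 ?scaler0.
  + rewrite crit_coef_sum; have [Tq|Tq] := eqVneq #|T| i.+1.
      by apply: (c0 (P, T)); rewrite /= cr Tq eqxx.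
    rewrite big1 // => a _; apply/eqP; rewrite mulf_eq0; apply/orP; right.
    apply: contraNT Tq => /crit_coef_support[s <- [u us _]].
    apply: contraTT us => sq; rewrite ysupp // mxE msupp0 //.
  by apply: (yfree c u) => s; apply/in_rows_aug; exact: uE.
- move=> g.
  pose cellP (c : {set 'I_n} * {set 'I_n}) := crit nr c.1 c.2 && (#|c.2| == i.+1).
  (* A combination of critical cells with the prescribed values [g]; its expansion in the classes
     [y a] gives the coefficients sought. *)
  pose w s := \sum_c (if cellP c then g c else 0)%:MP *: crit_cell K c.1 c.2 s.
  have [s sq|s|c [u wE]] := yspan w.
  + rewrite /w big1 // => c _; case: ifP => [/andP[_ /eqP cq]|_].
      by rewrite /crit_cell; case: (eqVneq s c.2) sq => [->|_ _]; rewrite ?cq ?eqxx // scaler0.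
    by rewrite mpolyC0 scale0r.
  + apply/in_rows_aug; rewrite koszul_diff_sum => P nP.
    rewrite summxE raddf_sum /= big1 // => c _; rewrite mxE mcoeffCM.
    case: ifP => [/andP[cr _]|_]; last by rewrite mul0r.
    by rewrite (crit_cell_cycle K nr_stable cr) ?mulr0.
  exists c => -[P T] /andP[/= cr cq]; rewrite -crit_coef_sum.
  have <- : crit_coef nr j0 w P T = g (P, T).
    rewrite crit_coef_sum (bigD1 (P, T)) //= /cellP /= cr cq.
    rewrite crit_coef_cell // !eqxx mulr1 big1 ?addr0 // => -[P' T'] /= ne.
    case: ifP => [/andP[cr' _]|_]; last by rewrite mul0r.
    rewrite crit_coef_cell //= -xpair_eqE eq_sym (negPf ne).
    by rewrite mulr0.
  have nP : nr P by case/and3P: cr.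
  set Y := fun s => _.
  pose h s := w s - Y s - koszul_diff u s.
  rewrite (@eq_crit_coef _ _ _ _ w (fun s => 1%:MP *: h s +
      (1%:MP *: koszul_diff u s + Y s))).
    rewrite !crit_coef_linear crit_coef_diff // (@crit_coef_nonstd _ _ _ _ h) //.
      by rewrite !mulr0 !add0r.
    by move=> s; apply/in_rows_aug; exact: wE.
  by move=> s; rewrite mpolyC1 !scale1r /h addrA subrK subrK.
Qed.

End CritBetti.

(** * Non-leading monomials *)

Section IdealSpan.
Local Open Scope ring_scope.
Variables (K : fieldType) (n : nat).
Implicit Types (A : {mpoly K[n]} -> Prop) (p q : {mpoly K[n]}).

Lemma ideal_span0 A : ideal_span A 0.
Proof. by exists [::]; rewrite ?big_nil. Qed.

Lemma ideal_span_gen A q : A q -> ideal_span A q.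
Proof.
by exists [:: (1, q)] => [cq|]; rewrite ?inE ?big_seq1 ?mul1r // => /eqP->.
Qed.

Lemma ideal_spanD A p q : ideal_span A p -> ideal_span A q -> ideal_span A (p + q).
Proof.
move=> [s sA ->] [t tA ->]; exists (s ++ t); last by rewrite big_cat.
by move=> cq; rewrite mem_cat => /orP[/sA|/tA].
Qed.

Lemma ideal_spanM A c p : ideal_span A p -> ideal_span A (c * p).
Proof.
move=> [s sA ->]; exists [seq (c * cq.1, cq.2) | cq <- s].
  by move=> _ /mapP[cq /sA h ->].
by rewrite big_map mulr_sumr; apply: eq_bigr => cq _; rewrite mulrA.
Qed.

Lemma ideal_span_sum A (T : eqType) (r : seq T) (F : T -> {mpoly K[n]}) :
  (forall i, i \in r -> ideal_span A (F i)) -> ideal_span A (\sum_(i <- r) F i).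
Proof.
move=> h; rewrite big_seq; elim/big_rec: _ => [|i p ir]; first exact: ideal_span0.
by apply: ideal_spanD; apply: h.
Qed.

Lemma ideal_span_sub A B p : (forall q, A q -> B q) -> ideal_span A p -> ideal_span B p.
Proof. by move=> AB [s sA ->]; exists s => // cq /sA/AB. Qed.

End IdealSpan.

Definition prefix_card n (P : {set 'I_n}) p := #|[set x in P | (x < p)%N]|.

(** After p steps the walk has height [2 * prefix_card P p] - p; the inequality avoids the
    subtraction. *)
Definition below n k (P : {set 'I_n}) :=
  [forall p : 'I_n.+1, 2 * prefix_card P p < k + p].

Section Lowest.
Local Open Scope ring_scope.
Variables (K : fieldType) (n : nat).
Implicit Types (p q w f : {mpoly K[n]}) (i : 'I_n) (P R : {set 'I_n}).

Definition multilinear w := forall i, w^`M(i)^`M(i) = 0.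

Definition sum_deriv w := \sum_i w^`M(i).

(** The apolarity pairing on squarefree monomials: for multilinear [w], multiplication by x_i is
    adjoint to the i-th partial derivative. *)
Definition set_pairing w f := \sum_(R : {set 'I_n}) f@_(mesym1 R) * w@_(mesym1 R).

Lemma multilinear_deriv w i : multilinear w -> multilinear w^`M(i).
Proof. by move=> h j; rewrite (mderiv_comm i j w) (mderiv_comm i j w^`M(j)) h mderiv0. Qed.

Lemma multilinear_sum_deriv w : multilinear w -> multilinear (sum_deriv w).
Proof.
move=> h j; have mderiv_sum (g : 'I_n -> {mpoly K[n]}) : (\sum_i g i)^`M(j) = \sum_i (g i)^`M(j).
  exact: (raddf_sum (mderiv j)).
rewrite /sum_deriv !mderiv_sum big1 // => i _; exact: (multilinear_deriv i h j).
Qed.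

Lemma pairing_mulX w f i : multilinear w ->
  set_pairing w ('X_i * f) = set_pairing w^`M(i) f.
Proof.
move=> h; rewrite /set_pairing (bigID (fun R : {set 'I_n} => i \in R)) /= addrC.
rewrite big1 ?add0r => [|R iR]; last first.
  by rewrite mcoeff_mulXi mesym1E (negPf iR) mul0r.
rewrite [RHS](bigID (fun R : {set 'I_n} => i \in R)) /= [X in _ = X + _]big1 ?add0r => [|R iR]; last first.
  have /mpolyP/(_ (mesym1 (R :\ i))) := h i.
  rewrite mcoeff_deriv -mesym1D1 // mesym1E !inE eqxx mcoeff0 mulr1n => ->.
  by rewrite mulr0.
rewrite (reindex_onto (fun R => i |: R) (fun R => R :\ i)) /=; last first.
  by move=> R iR; rewrite setD1K.
apply: eq_big => [R|R /andP[_ /eqP iR]].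
  rewrite setU11 /=; apply/eqP/idP => [<-|iR]; first by rewrite !inE eqxx.
  by rewrite setU1K.
have {}iR : i \notin R by rewrite -iR !inE eqxx.
rewrite mcoeff_mulXi mesym1E setU11 /= mesym1U1 // addmK mcoeff_deriv.
by rewrite mesym1E (negPf iR).
Qed.

Lemma pairingD w f g : set_pairing w (f + g) = set_pairing w f + set_pairing w g.
Proof.
by rewrite /set_pairing -big_split; apply: eq_bigr => R _; rewrite mcoeffD mulrDl.
Qed.

Lemma pairing_sumX w f : multilinear w ->
  set_pairing w ((\sum_i 'X_i) * f) = set_pairing (sum_deriv w) f.
Proof.
move=> h; rewrite mulr_suml /sum_deriv.
have -> : set_pairing w (\sum_i 'X_i * f) = \sum_i set_pairing w ('X_i * f).
  rewrite /set_pairing exchange_big; apply: eq_bigr => R _ /=.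
  by rewrite raddf_sum /= mulr_suml.
rewrite (eq_bigr _ (fun i _ => pairing_mulX f i h)) /set_pairing exchange_big /=.
by apply: eq_bigr => R _; rewrite raddf_sum /= mulr_sumr.
Qed.

Lemma pairing_powX w f k : multilinear w ->
  set_pairing w ((\sum_i 'X_i) ^+ k * f) = set_pairing (iter k sum_deriv w) f.
Proof.
elim: k w => [|k IH] w h; first by rewrite expr0 mul1r.
by rewrite exprS -mulrA pairing_sumX // IH ?iterSr //; apply: multilinear_sum_deriv.
Qed.

Lemma pairing0 f : set_pairing 0 f = 0.
Proof. by apply: big1 => R _; rewrite mcoeff0 mulr0. Qed.

Lemma pairing_ideal w f k : multilinear w -> iter k sum_deriv w = 0 ->
  squares_power_ideal K n k f -> set_pairing w f = 0.
Proof.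
move=> wm wk [s sI ->]; elim: s sI => [|cq s IH] sI.
  by rewrite big_nil; apply: big1 => R _; rewrite mcoeff0 mul0r.
rewrite big_cons pairingD IH ?addr0; last by move=> q qs; apply: sI; rewrite inE qs orbT.
have [[i ->]|->] := sI cq (mem_head _ _); rewrite mulrC.
  rewrite expr2 -mulrA !pairing_mulX // ?wm ?pairing0 //.
  exact: multilinear_deriv.
by rewrite pairing_powX // wk pairing0.
Qed.

Lemma sum_deriv_mulX w i : sum_deriv ('X_i * w) = w + 'X_i * sum_deriv w.
Proof.
rewrite /sum_deriv (eq_bigr _ (fun j _ => mderivM j 'X_i w)) big_split /= mulr_sumr.
congr (_ + _); rewrite (bigD1 i) //= big1 ?addr0 => [|j ji].
  by rewrite mderivX mnm1E eqxx -{1}[U_(i)%MM]add0m addmK mpolyX0 scale1r mul1r.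
by rewrite mderivX mnm1E eq_sym (negPf ji) scale0r mul0r.
Qed.

Lemma sum_derivB p q : sum_deriv (p - q) = sum_deriv p - sum_deriv q.
Proof. by rewrite /sum_deriv -sumrB; apply: eq_bigr => i _; rewrite mderivB. Qed.

Lemma iter_sum_deriv_mulX N w i : iter N sum_deriv w = 0 ->
  iter N.+1 sum_deriv ('X_i * w) = 0.
Proof.
elim: N w => [|N IH] w w0.
  rewrite /= sum_deriv_mulX; move: w0 => /= ->; rewrite add0r.
  by rewrite /sum_deriv big1 ?mulr0 // => j _; rewrite mderiv0.
rewrite iterSr sum_deriv_mulX.
have iterD M p q : iter M sum_deriv (p + q) = iter M sum_deriv p + iter M sum_deriv q.
  elim: M => //= M ->; rewrite /sum_deriv -big_split; apply: eq_bigr => j _.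
  exact: mderivD.
by rewrite iterD w0 add0r IH // -iterSr.
Qed.

(** The sum of the partial derivatives kills x_i - x_j, so it commutes with multiplication by this
    factor. *)
Lemma iter_sum_deriv_mulB N w i j : iter N sum_deriv w = 0 ->
  iter N sum_deriv (('X_i - 'X_j) * w) = 0.
Proof.
move=> w0.
suff -> : iter N sum_deriv (('X_i - 'X_j) * w) = ('X_i - 'X_j) * iter N sum_deriv w.
  by rewrite w0 mulr0.
elim: N {w0} => //= N ->; rewrite mulrBl sum_derivB !sum_deriv_mulX mulrBl.
by rewrite opprD addrACA subrr add0r.
Qed.

Variable le : rel 'X_{1..n}.
Hypothesis le_term : term_order le.
Hypothesis le_vars : decreasing_vars le.

Lemma term_order_refl u : le u u.
Proof. by have := term_order_total le_term u u; rewrite orbb. Qed.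

Lemma prefix_cardS P (i : 'I_n) :
  prefix_card P i.+1 = ((i \in P) + prefix_card P i)%N.
Proof.
rewrite /prefix_card (cardsD1 i) inE ltnSn andbT; congr (_ + _)%N.
apply: eq_card => x; rewrite !inE; case: (x \in P); rewrite ?andbF //=.
by rewrite ltnS -val_eqE /= ltn_neqAle.
Qed.

Definition prefix P s : {set 'I_n} := [set x in P | (x < s)%N].

Lemma prefixS P (i : 'I_n) :
  prefix P i.+1 = if i \in P then i |: prefix P i else prefix P i.
Proof.
apply/setP=> x; rewrite !inE ltnS leq_eqVlt val_eqE.
case: ifP => iP; rewrite !inE; case: eqVneq => [->|_] //=.
  by rewrite iP.
by rewrite iP.
Qed.

(* Reading the walk of P from left to right, every up-step is matched with an
   earlier unmatched down-step if there is one; B collects the down-steps still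
   unmatched, and u counts the unmatched up-steps, that is, the maximal height.
   A matched pair contributes the factor x_i - x_b and an unmatched up-step the
   factor x_i. *)
Lemma lowest_prefix P s : (s <= n)%N -> exists w (B : {set 'I_n}) u,
  [/\ (forall i, i \in B -> (i < s)%N && (i \notin P)),
      (forall i, (i \in B) || (s <= i)%N -> w^`M(i) = 0) /\ multilinear w,
      iter u.+1 sum_deriv w = 0,
      w@_(mesym1 (prefix P s)) = 1 /\
        (forall v, v \in msupp w -> le (mesym1 (prefix P s)) v) &
      (u + s = 2 * prefix_card P s + #|B|)%N /\
        (exists2 p, (p <= s)%N & (2 * prefix_card P p = u + p)%N)].
Proof.
elim: s => [_|s IH sn].
  exists 1, set0, 0%N; have -> : prefix P 0 = set0.
    by apply/setP=> x; rewrite !inE andbF.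
  have d1 i : (1 : {mpoly K[n]})^`M(i) = 0 by rewrite -mpolyC1 mderivC.
  split=> [i||||]; first by rewrite inE.
  - by split=> [i _|i]; rewrite d1 ?mderiv0.
  - by rewrite /= /sum_deriv big1.
  - rewrite mesym1_set0 mcoeff1 eqxx; split=> // v.
    by rewrite msupp1 inE => /eqP ->; apply: term_order_refl.
  - have p0 : prefix_card P 0 = 0%N.
      by apply/eqP; rewrite cards_eq0; apply/eqP/setP=> x; rewrite !inE andbF.
    by rewrite cards0 p0; split=> //; exists 0%N; rewrite ?p0.
have [w [B [u [BP [wB wm] wu [w1 wle] [hu hp]]]]] := IH (ltnW sn).
pose i := Ordinal sn.
have cS : prefix_card P s.+1 = ((i \in P) + prefix_card P s)%N := prefix_cardS P i.
have -> : prefix P s.+1 = if i \in P then i |: prefix P s else prefix P s.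
  exact: (prefixS P i).
rewrite cS.
have iB : i \notin B by apply/negP => /BP; rewrite ltnn.
have wi : w^`M(i) = 0 by apply: wB; rewrite leqnn orbT.
(* A down-step leaves [w] unchanged and makes the position [i] available for matching. *)
case: ifP => iP; last first.
  exists w, (i |: B), u; split=> //.
  - move=> j; rewrite !inE => /orP[/eqP->|/BP /andP[js ->]].
      by rewrite iP ltnSn.
    by rewrite ltnS ltnW.
  - split=> // j; rewrite !inE => h; apply: wB; move: h.
    by case: (eqVneq j i) => [->|_] /=; rewrite ?leqnn ?orbT // =>
      /orP[->//|/ltnW->]; rewrite orbT.
  - split; first by rewrite cardsU1 iB add0n add1n !addnS hu.
    by case: hp => p hp1 hp2; exists p => //; apply: leq_trans (leqnSn _).
have iPs : i \notin prefix P i by rewrite inE ltnn andbF.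
have E : mesym1 (i |: prefix P s) = (mesym1 (prefix P s) + U_(i))%MM.
  by rewrite mesym1U1.
have leXi v : v \in msupp ('X_i * w) -> le (mesym1 (i |: prefix P s)) v.
  rewrite mpoly_mulC (perm_mem (msuppMX _ _)) => /mapP[v' /wle hv ->].
  by rewrite E [(U_(i) + _)%MM]addmC; apply: term_order_add.
have co : ('X_i * w)@_(mesym1 (i |: prefix P s)) = 1.
  by rewrite mcoeff_mulXi E mnmDE mnm1E eqxx addn1 addmK.
have dX (l j : 'I_n) : ('X_l : {mpoly K[n]})^`M(j)^`M(j) = 0.
  rewrite mderivX mderivZ mderivX mnmBE !mnm1E eqxx.
  by case: (l == j); rewrite ?subnn ?sub0n ?scale0r ?scaler0.
have dXX (l j : 'I_n) : l != j -> ('X_l : {mpoly K[n]})^`M(j) = 0.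
  by move=> lj; rewrite mderivX mnm1E (negPf lj) scale0r.
have dmul (l : {mpoly K[n]}) j : l^`M(j)^`M(j) = 0 -> l^`M(j) = 0 \/ w^`M(j) = 0 ->
    (l * w)^`M(j)^`M(j) = 0.
  move=> l2 h; rewrite mderivM mderivD !mderivM l2 wm mul0r mulr0 add0r addr0.
  by case: h => ->; rewrite ?mul0r ?mulr0 addr0.
(* If no down-step is available, the walk reaches a new maximum at s + 1, and the factor x_i raises
   the order of nilpotency by one. *)
have [B0|/set0Pn[b bB]] := eqVneq B set0.
  exists ('X_i * w), set0, u.+1; split.
  - by move=> j; rewrite inE.
  - split=> [j|j]; last first.
      apply: dmul; first exact: dX.
      case: (eqVneq i j) => [<-|ij]; [by right|left].
      exact: dXX.
    rewrite inE /= => ij; rewrite mderivM dXX ?wB ?mul0r ?mulr0 ?addr0 //.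
      by rewrite (ltnW ij) orbT.
    by rewrite -val_eqE /= neq_ltn ij.
  - exact: iter_sum_deriv_mulX.
  - by split.
  - rewrite cards0; move: hu; rewrite B0 cards0 => hu.
    split; first by lia.
    by exists s.+1 => //; rewrite cS iP; lia.
have /andP[bi bP] := BP b bB.
have wb : w^`M(b) = 0 by apply: wB; rewrite bB.
(* Any available [b] will do: b < i makes x_b larger than x_i, so the lowest monomial is multiplied
   by x_i. *)
exists (('X_i - 'X_b) * w), (B :\ b), u; split.
- by move=> j; rewrite !inE => /andP[_ /BP/andP[js ->]]; rewrite ltnS ltnW.
- split=> [j|j]; last first.
    apply: dmul; first by rewrite !mderivB !dX subrr.
    rewrite mderivB; case: (eqVneq i j) => [<-|ij]; [by right|].
    case: (eqVneq b j) => [<-|bj]; [by right|left].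
    by rewrite !dXX // subrr.
  rewrite !inE => h; rewrite mderivM mderivB !dXX ?subrr ?wB ?mul0r ?mulr0 ?addr0 //.
  + by case/orP: h => [/andP[_ ->//]|/ltnW->]; rewrite orbT.
  + apply: contraTneq h => <-; rewrite eqxx /= -leqNgt ltnW //.
  + by apply: contraTneq h => <-; rewrite (negPf iB) andbF ltnn.
- exact: iter_sum_deriv_mulB.
- rewrite mulrBl mcoeffB co mcoeff_mulXi mesym1E !inE (negPf bP) andFb orbF.
  have -> : (b == i) = false by rewrite -val_eqE /= ltn_eqF.
  rewrite subr0; split=> // v /msuppB_le; rewrite mem_cat => /orP[/leXi//|].
  rewrite mpoly_mulC (perm_mem (msuppMX _ _)) => /mapP[v' /wle hv ->].
  rewrite E [(U_(b) + _)%MM]addmC.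
  apply: (term_order_trans le_term (y := (mesym1 (prefix P s) + U_(b))%MM)).
    rewrite ![(mesym1 _ + _)%MM]addmC; apply: term_order_add => //.
    by case/andP: (@le_vars b i bi).
  exact: term_order_add.
- move: hu; rewrite (cardsD1 b B) bB add1n add1n addnS => hu.
  split; first by rewrite addnS hu; lia.
  by case: hp => p hp1 hp2; exists p => //; apply: leq_trans (leqnSn _).
Qed.

End Lowest.

(** * The initial ideal *)

Section Below.
Variables (n : nat).
Implicit Types (P Q : {set 'I_n}).

Lemma prefix_card_sub Q P p : Q \subset P -> prefix_card Q p <= prefix_card P p.
Proof.
move/subsetP=> QP; apply/subset_leq_card/subsetP => x.
by rewrite !inE => /andP[/QP-> ->].
Qed.

Lemma prefix_cardU1 P (j : 'I_n) p : j \notin P ->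
  prefix_card (j |: P) p = (j < p) + prefix_card P p.
Proof.
move=> jP; rewrite /prefix_card.
have [jp|pj] := ltnP j p.
  have -> : [set x in j |: P | x < p] = j |: [set x in P | x < p].
    by apply/setP=> l; rewrite !inE; case: eqP => // ->; rewrite jp.
  by rewrite cardsU1 inE (negPf jP).
congr #|pred_of_set _|; apply/setP=> l; rewrite !inE.
by case: eqP => //= ->; rewrite ltnNge pj /= andbF.
Qed.

Lemma prefix_card_all P p : n <= p -> prefix_card P p = #|P|.
Proof.
move=> np; apply: eq_card => x; rewrite !inE.
by rewrite (leq_trans (ltn_ord x) np) andbT.
Qed.

Lemma prefix_card_le P p : prefix_card P p <= #|P|.
Proof. by apply/subset_leq_card/subsetP => x; rewrite inE => /andP[]. Qed.

Lemma belowP k P :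
  reflect (forall p, p <= n -> 2 * prefix_card P p < k + p) (below k P).
Proof.
apply: (iffP forallP) => [h p pn|h p]; first exact: (h (Ordinal (pn : p < n.+1))).
by apply: h; rewrite -ltnS.
Qed.

Lemma belowPn k P :
  reflect (exists2 p, p <= n & k + p <= 2 * prefix_card P p) (~~ below k P).
Proof.
apply: (iffP idP) => [|[p pn h]].
  by rewrite negb_forall => /existsP[p h]; exists p; [rewrite -ltnS | rewrite leqNgt].
by apply/belowP => /(_ p pn); rewrite ltnNge h.
Qed.

Lemma below_down k P Q : Q \subset P -> below k P -> below k Q.
Proof.
move=> QP /belowP h; apply/belowP => p /h; apply: leq_ltn_trans.
by rewrite leq_mul2l prefix_card_sub.
Qed.

Lemma below_stable k P (j t : 'I_n) : j < t -> j \notin P -> t \notin P ->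
  ~~ below k (t |: P) -> ~~ below k (j |: P).
Proof.
move=> jt jP tP /belowPn[p pn h]; apply/belowPn; exists p => //.
apply: leq_trans h _; rewrite !prefix_cardU1 // leq_mul2l leq_add2r /=.
by case: (ltnP t p) => // tp; rewrite (ltn_trans jt tp).
Qed.

Lemma prefix_card_leq P p : prefix_card P p <= p.
Proof.
apply: leq_trans (_ : _ <= size (iota 0 p)) _; last by rewrite size_iota.
rewrite /prefix_card cardE -(size_map val).
apply: uniq_leq_size; first by rewrite (map_inj_uniq val_inj) enum_uniq.
move=> y /mapP[x]; rewrite mem_enum inE => /andP[_ xp] ->.
by rewrite mem_iota.
Qed.

Lemma below_card k P : #|P| < k -> below k P.
Proof.
move=> h; apply/belowP => p _.
have := prefix_card_le P p; have := prefix_card_leq P p; lia.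
Qed.

End Below.

Section Initial.
Local Open Scope ring_scope.
Variables (K : fieldType) (n : nat).
Implicit Types (p q w f r g : {mpoly K[n]}) (i : 'I_n) (P R : {set 'I_n}).

Section TermOrder.
Variable le : rel 'X_{1..n}.
Hypothesis le_term : term_order le.
Hypothesis le_vars : decreasing_vars le.

(** If x_P with P below k were leading in [f], then P alone would contribute to the pairing with the
    polynomial [w] of P, since the monomials of [f] are at most x_P and those of [w] at least x_P.
    But [w] annihilates the ideal. *)
Lemma leading_nonstd k f u : squares_power_ideal K n k f ->
  is_leading_monomial le f u -> nonstd (below k) ('X_[u] : {mpoly K[n]}).
Proof.
move=> fI [uf ufmax] P nP; rewrite mcoeffX; case: eqP => // uP.
have [w [B [v [_ [_ wm] wv [w1 wle] [_ [p pn hp]]]]]] :=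
  lowest_prefix K le_term le_vars P (leqnn n).
have prefE : prefix P n = P by apply/setP=> x; rewrite inE ltn_ord andbT.
rewrite prefE in w1 wle.
(* The walk attains the height [v] at [p], so [v] is less than k. *)
have vk : (v.+1 <= k)%N by have /belowP/(_ p pn) := nP; rewrite hp; lia.
have w0 : iter k (@sum_deriv K n) w = 0.
  rewrite -(subnK vk) iterD wv; elim: (k - _)%N => //= N ->.
  by apply: big1 => i _; rewrite mderiv0.
have := pairing_ideal wm w0 fI; rewrite /set_pairing (bigD1 P) //= w1 mulr1.
rewrite big1 ?addr0 => [f0|R RP].
  by move: uf; rewrite mcoeff_msupp uP f0 eqxx.
apply: contraNeq RP; rewrite mulf_eq0 negb_or -!mcoeff_msupp => /andP[Rf Rw].
apply/eqP/inj_mesym1/(term_order_anti le_term).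
by rewrite wle // -uP ufmax.
Qed.

Lemma nonstdM k c p : nonstd (below k) p -> nonstd (below k) (c * p).
Proof.
move=> hp P nP; apply/eqP; rewrite mcoeff_eq0; apply/negP => /msuppM_le.
move=> /allpairsP[[u v] /= [_ vp E]].
have vE : v = mesym1 (msupport v).
  apply/mnmP => i; rewrite mesym1E inE.
  have := congr1 (fun m : 'X_{1..n} => m i) E; rewrite mnmDE mesym1E.
  by case: (v i) => [|[|x]] //=; case: (i \in P); lia.
have := vp; rewrite mcoeff_msupp vE hp ?eqxx //.
apply: below_down nP; apply/subsetP => i; rewrite inE => vi.
have := congr1 (fun m : 'X_{1..n} => m i) E; rewrite mnmDE mesym1E.
by case: (i \in P) => //; case: (v i) vi => // x _; rewrite addnS.
Qed.

Lemma nonstdD k p q :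
  nonstd (below k) p -> nonstd (below k) q -> nonstd (below k) (p + q).
Proof. by move=> hp hq P nP; rewrite mcoeffD hp // hq // addr0. Qed.

Lemma initial_nonstd k p :
  initial_ideal le (squares_power_ideal K n k) p -> nonstd (below k) p.
Proof.
case=> s sI ->; elim: s sI => [|cq s IH] sI.
  by rewrite big_nil => P _; rewrite mcoeff0.
rewrite big_cons; apply: nonstdD; last first.
  by apply: IH => q qs; apply: sI; rewrite inE qs orbT.
apply: nonstdM; have [f [u [fI fu ->]]] := sI cq (mem_head _ _).
exact: leading_nonstd fu.
Qed.

Lemma exists_leading p : p != 0 -> exists u, is_leading_monomial le p u.
Proof.
rewrite -msupp_eq0 /is_leading_monomial; move: (msupp p) => s.
elim: s => // u [|v s] IH _.
  exists u; split=> [|x]; rewrite inE // => /eqP->; exact: term_order_refl.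
have [//|w [ws wmax]] := IH.
have /orP[uw|wu] := term_order_total le_term u w.
  exists w; split; first by rewrite inE ws orbT.
  by move=> x; rewrite inE => /orP[/eqP->//|/wmax].
exists u; split; first exact: mem_head.
move=> x; rewrite inE => /orP[/eqP->|/wmax xw]; first exact: term_order_refl.
exact: (term_order_trans le_term) wu.
Qed.

End TermOrder.

(** * Spanning of the quotient by standard monomials *)

Definition suffix_sum s : {mpoly K[n]} := \sum_(i < n | (s <= i)%N) 'X_i.

Definition squares_ideal := ideal_span (fun q : {mpoly K[n]} => exists i, q = 'X_i ^+ 2).

(** The walk of R is started at height 0 in position s and has to stay below k. *)
Definition suffix_std s k r := forall u, u \in msupp r -> exists R,
  [/\ u = mesym1 R, forall i, i \in R -> (s <= i)%N &
      forall t, (s <= t <= n)%N -> (2 * prefix_card R t + s < k + t)%N].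

Definition vars_ge s g := forall u, u \in msupp g -> forall i, (i < s)%N -> u i = 0%N.

Definition suffix_span s k p := exists r g,
  [/\ suffix_std s k r, vars_ge s g & squares_ideal (p - r - suffix_sum s ^+ k * g)].

Lemma vars_geD s p q : vars_ge s p -> vars_ge s q -> vars_ge s (p + q).
Proof. by move=> hp hq u /msuppD_le; rewrite mem_cat => /orP[/hp|/hq]. Qed.

Lemma vars_geM s p q : vars_ge s p -> vars_ge s q -> vars_ge s (p * q).
Proof.
move=> hp hq u /msuppM_le /allpairsP[[v w] /= [/hp hv /hq hw ->]] i si.
by rewrite mnmDE hv // hw.
Qed.

Lemma vars_geC s c : vars_ge s c%:MP.
Proof.
by move=> u; rewrite msuppC; case: ifP; rewrite ?inE // => _ /eqP-> i _; rewrite mnm0E.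
Qed.

Lemma vars_ge_exp s p k : vars_ge s p -> vars_ge s (p ^+ k).
Proof.
move=> hp; elim: k => [|k IH]; first by rewrite expr0 -mpolyC1; apply: vars_geC.
by rewrite exprS; apply: vars_geM.
Qed.

Lemma vars_ge_X s i : (s <= i)%N -> vars_ge s 'X_i.
Proof.
move=> si u; rewrite msuppX inE => /eqP-> j js; rewrite mnm1E.
by case: eqP => // ij; move: js; rewrite -ij ltnNge si.
Qed.

Lemma vars_ge_le s t p : (s <= t)%N -> vars_ge t p -> vars_ge s p.
Proof. by move=> st hp u /hp h i si; apply: h; apply: leq_trans st. Qed.

Lemma vars_ge_suffix_sum s : vars_ge s (suffix_sum s).
Proof.
rewrite /suffix_sum; elim/big_rec: _ => [|i p si].
  by move=> u; rewrite msupp0.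
by apply: vars_geD; apply: vars_ge_X.
Qed.

Lemma suffix_stdD s k p q : suffix_std s k p -> suffix_std s k q -> suffix_std s k (p + q).
Proof. by move=> hp hq u /msuppD_le; rewrite mem_cat => /orP[/hp|/hq]. Qed.

Lemma suffix_std0 s k : suffix_std s k 0.
Proof. by move=> u; rewrite msupp0. Qed.

Lemma suffix_spanD s k p q :
  suffix_span s k p -> suffix_span s k q -> suffix_span s k (p + q).
Proof.
move=> [r [g [hr hg hI]]] [r' [g' [hr' hg' hI']]].
exists (r + r'), (g + g'); split; [exact: suffix_stdD|exact: vars_geD|].
have -> : p + q - (r + r') - suffix_sum s ^+ k * (g + g') =
  (p - r - suffix_sum s ^+ k * g) + (q - r' - suffix_sum s ^+ k * g') by ring.
exact: ideal_spanD.
Qed.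

Lemma suffix_spanZ s k c p : suffix_span s k p -> suffix_span s k (c%:MP * p).
Proof.
move=> [r [g [hr hg hI]]].
exists (c%:MP * r), (c%:MP * g); split.
- by move=> u; rewrite mul_mpolyC => /msuppZ_le/hr.
- by apply: vars_geM => //; apply: vars_geC.
have -> : c%:MP * p - c%:MP * r - suffix_sum s ^+ k * (c%:MP * g) =
  c%:MP * (p - r - suffix_sum s ^+ k * g) by ring.
exact: ideal_spanM.
Qed.

Lemma suffix_span_sq s k p q : squares_ideal (p - q) ->
  suffix_span s k q -> suffix_span s k p.
Proof.
move=> hpq [r [g [hr hg hI]]]; exists r, g; split=> //.
have -> : p - r - suffix_sum s ^+ k * g =
  (p - q) + (q - r - suffix_sum s ^+ k * g) by ring.
exact: ideal_spanD.
Qed.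

Lemma suffix_sumS (i : 'I_n) : suffix_sum i = 'X_i + suffix_sum i.+1.
Proof.
rewrite /suffix_sum (bigD1 i) //=; congr (_ + _); apply: eq_bigl => j.
by rewrite -val_eqE /= ltn_neqAle eq_sym andbC.
Qed.

Lemma expr_add_mod2 (a x : {mpoly K[n]}) k :
  exists q, (a + x) ^+ k.+1 = a ^+ k.+1 + k.+1%:R * x * a ^+ k + x ^+ 2 * q.
Proof.
elim: k => [|k [q IH]]; first by exists 0; rewrite !expr1 expr0; ring.
exists (q * (a + x) + k.+1%:R * a ^+ k).
rewrite [LHS]exprSr IH [a ^+ k.+2]exprSr [a ^+ k.+1]exprSr -[in RHS](natr1 k.+1).
ring.
Qed.

Hypothesis char0 : [pchar K] =i pred0.

(* Modulo x^2, k x l^(k-1) = (x + l)^k - l^k where l is the sum of the variables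
   after x: a monomial divisible by x is reduced with exponent k - 1 on the
   remaining variables, and one without x with exponent k + 1. *)
Lemma suffix_spanP s : (s <= n)%N -> forall k p, vars_ge s p -> suffix_span s k p.
Proof.
move: {2}(n - s)%N (erefl (n - s)%N) => N; elim: N s => [|N IH] s.
  move=> ns0 sn; have -> : s = n by lia.
  move=> [|k] p hp.
    exists 0, p; split=> //; first exact: suffix_std0.
    by rewrite expr0 mul1r subr0 subrr; apply: ideal_span0.
  exists p, 0; split.
  - move=> u up; exists set0; split=> [|i|q qn].
    + rewrite mesym1_set0; apply/mnmP=> i; rewrite mnm0E; exact: hp (ltn_ord i).
    + by rewrite inE.
    + have -> : prefix_card (set0 : {set 'I_n}) q = 0%N.
        by apply/eqP; rewrite -leqn0 -[0%N](cards0 'I_n) prefix_card_le.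
      by lia.
  - by move=> u; rewrite msupp0.
  by rewrite mulr0 subr0 subrr; apply: ideal_span0.
move=> nsN sn k.
have sn' : (s < n)%N by lia.
have {}IH := IH s.+1 (ltac:(lia)) sn'.
pose i := Ordinal sn'.
have lE : suffix_sum s = 'X_i + suffix_sum s.+1 := suffix_sumS i.
have xsq q : squares_ideal ('X_i ^+ 2 * q).
  by rewrite mulrC; apply/ideal_spanM/ideal_span_gen; exists i.
case: k => [|k] p hp.
  exists 0, p; split=> //; first exact: suffix_std0.
  by rewrite expr0 mul1r subr0 subrr; apply: ideal_span0.
(* Down-step at i: with l = [suffix_sum s], modulo x_i^2 the power (l - x_i)^(k+2) equals l^(k+1) (l
   - (k+2) x_i), a multiple of l^(k+1). *)
have free q : vars_ge s.+1 q -> suffix_span s k.+1 q.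
  move=> hq; have [r [g [hr hg hI]]] := IH k.+2 q hq.
  have [z zE] := expr_add_mod2 (suffix_sum s) (- 'X_i) k.+1.
  have lE' : suffix_sum s + - 'X_i = suffix_sum s.+1 by rewrite lE addrAC subrr add0r.
  exists r, ((suffix_sum s - k.+2%:R * 'X_i) * g); split.
  - move=> u /hr[R [-> Rs Rk]]; exists R; split=> // [j /Rs/ltnW//|t].
    case/andP; rewrite leq_eqVlt => /orP[/eqP<- _|st tn]; last first.
      by have := Rk t; rewrite st tn => /(_ isT); lia.
    have -> : prefix_card R s = 0%N.
      apply/eqP; rewrite cards_eq0; apply/eqP/setP=> x; rewrite !inE.
      by apply/negbTE/negP=> /andP[/Rs]; lia.
    by lia.
  - apply: vars_geM (vars_ge_le (leqnSn s) hg).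
    apply: vars_geD; first exact: vars_ge_suffix_sum.
    rewrite -mulNr -mpolyC_nat -mpolyCN; apply: vars_geM; first exact: vars_geC.
    exact: vars_ge_X.
  have -> : q - r - suffix_sum s ^+ k.+1 * ((suffix_sum s - k.+2%:R * 'X_i) * g) =
     (q - r - suffix_sum s.+1 ^+ k.+2 * g) + 'X_i ^+ 2 * (z * g).
    rewrite -lE' zE [suffix_sum s ^+ k.+2]exprSr sqrrN; ring.
  apply: ideal_spanD; [exact: hI|exact: xsq].
(* Up-step at i: with l' = [suffix_sum s.+1], modulo x_i^2 the product x_i l'^k is ((x_i + l')^(k+1)
   - l'^(k+1)) / (k+1). The multiple of l'^(k+1) is free of x_i and falls under [free]. *)
have mulx q : vars_ge s.+1 q -> suffix_span s k.+1 ('X_i * q).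
  move=> hq; have [r [g [hr hg hI]]] := IH k q hq.
  have [z zE] := expr_add_mod2 (suffix_sum s.+1) 'X_i k.
  have k0 : k.+1%:R != 0 :> K by rewrite (pcharf0P _).1.
  apply: (@suffix_span_sq _ _ _ ('X_i * r + ((k.+1%:R)^-1 : K)%:MP *
      (suffix_sum s ^+ k.+1 * g + (- suffix_sum s.+1 ^+ k.+1 * g)))).
    have -> : suffix_sum s ^+ k.+1 * g + (- suffix_sum s.+1 ^+ k.+1 * g) =
       k.+1%:R * ('X_i * suffix_sum s.+1 ^+ k * g) + 'X_i ^+ 2 * (z * g).
      by rewrite lE addrC [_ + suffix_sum _]addrC zE; ring.
    set y := 'X_i * suffix_sum s.+1 ^+ k * g.
    have yE : ((k.+1%:R)^-1 : K)%:MP * (k.+1%:R * y) = y.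
      by rewrite mulrA -mpolyC_nat -mpolyCM mulVf // mpolyC1 mul1r.
    rewrite mulrDr yE.
    have -> : 'X_i * q - ('X_i * r + (y + ((k.+1%:R)^-1 : K)%:MP * ('X_i ^+ 2 * (z * g)))) =
      'X_i * (q - r - suffix_sum s.+1 ^+ k * g) +
        'X_i ^+ 2 * (- ((k.+1%:R)^-1 : K)%:MP * (z * g)) by rewrite /y; ring.
    apply: ideal_spanD; [exact: ideal_spanM | exact: xsq].
  apply: suffix_spanD; last apply: suffix_spanZ; last apply: suffix_spanD.
  - exists ('X_i * r), 0; split.
    + move=> u; rewrite mpoly_mulC (perm_mem (msuppMX _ _)) => /mapP[v /hr[R [-> Rs Rk]] ->].
      have iR : i \notin R by apply/negP => /Rs; rewrite ltnn.
      exists (i |: R); split; first by rewrite mesym1U1 // addmC.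
        by move=> j; rewrite !inE => /orP[/eqP->|/Rs/ltnW].
      move=> t /andP[]; rewrite leq_eqVlt => /orP[/eqP<- _|st tn]; last first.
        rewrite prefix_cardU1 // /= st; have := Rk t; rewrite st tn => /(_ isT); lia.
      rewrite prefix_cardU1 //= ltnn add0n.
      have -> : prefix_card R s = 0%N.
        apply/eqP; rewrite cards_eq0; apply/eqP/setP=> x; rewrite !inE.
        by apply/negbTE/negP=> /andP[/Rs]; lia.
      by lia.
    + by move=> u; rewrite msupp0.
    by rewrite mulr0 subr0 subrr; apply: ideal_span0.
  - exists 0, g; split; first exact: suffix_std0.
      exact: vars_ge_le hg.
    by rewrite subr0 subrr; apply: ideal_span0.
  - apply: free; apply: vars_geM hg; rewrite -mulN1r -mpolyC1 -mpolyCN.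
    by apply: vars_geM; [exact: vars_geC | apply/vars_ge_exp/vars_ge_suffix_sum].
rewrite [p]mpolyE big_seq; elim/big_rec: _ => [|u q up].
  exists 0, 0; split; first exact: suffix_std0.
    by move=> u; rewrite msupp0.
  by rewrite mulr0 !subr0; apply: ideal_span0.
apply: suffix_spanD; rewrite -mul_mpolyC; apply: suffix_spanZ.
have hu := hp u up.
have above (v : 'X_{1..n}) : (forall j : 'I_n, (j < s.+1)%N -> v j = 0%N) -> vars_ge s.+1 'X_[v].
  by move=> h w; rewrite msuppX inE => /eqP->.
have lti (v : 'X_{1..n}) : v i = 0%N -> (forall j : 'I_n, (j < s)%N -> v j = 0%N) ->
    forall j : 'I_n, (j < s.+1)%N -> v j = 0%N.
  move=> vi h j; rewrite ltnS leq_eqVlt => /orP[/eqP js|/h//].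
  by have -> : j = i by exact: val_inj.
have [ui|ui|ui] := ltngtP (u i) 1.
- by apply/free/above/lti => //; move: ui; case: (u i).
- have le2 : (U_(i) *+ 2 <= u)%MM.
    by apply/mnm_lepP => j; rewrite mulmnE mnm1E; case: eqP => // <-; rewrite mul1n.
  apply: (@suffix_span_sq _ _ _ 0).
    rewrite subr0 -(submK le2) mpolyXD mulrC -mpolyXn; exact: xsq.
  exists 0, 0; split; first exact: suffix_std0.
    by move=> v; rewrite msupp0.
  by rewrite mulr0 !subr0; apply: ideal_span0.
- have le1 : (U_(i) <= u)%MM by rewrite lep1mP ui.
  rewrite -(submK le1) mpolyXD mulrC; apply/mulx/above/lti.
    by rewrite mnmBE mnm1E eqxx ui.
  by move=> j js; rewrite mnmBE hu.
Qed.

(** For the converse, a nonstandard monomial either is divisible by a square or is x_P with P not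
    below k. In the latter case x_P minus its standard expansion lies in the ideal; its leading
    monomial is nonstandard, so it can only be x_P. *)
Lemma initial_idealE (le : rel 'X_{1..n}) k p :
    term_order le -> decreasing_vars le ->
  initial_ideal le (squares_power_ideal K n k) p <-> nonstd (below k) p.
Proof.
move=> le_term le_vars; split; first exact: initial_nonstd.
move=> hp; rewrite [p]mpolyE; apply: ideal_span_sum => u up.
rewrite -mul_mpolyC; apply: ideal_spanM.
have [/existsP[i ui]|] := boolP [exists i, (1 < u i)%N].
  have le2 : (U_(i) *+ 2 <= u)%MM.
    by apply/mnm_lepP => j; rewrite mulmnE mnm1E; case: eqP => // <-; rewrite mul1n.
  rewrite -(submK le2) mpolyXD; apply/ideal_spanM/ideal_span_gen.
  exists 'X_[U_(i) *+ 2], (U_(i) *+ 2)%MM; split=> //.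
    by apply: ideal_span_gen; left; exists i; rewrite mpolyXn.
  split=> [|v]; rewrite msuppX inE // => /eqP->; exact: term_order_refl.
rewrite negb_exists => /forallP u1.
have uE : u = mesym1 (msupport u).
  apply/mnmP=> i; rewrite mesym1E inE; have := u1 i.
  by case: (u i) => [|[|x]].
set P := msupport u in uE.
have nP : ~~ below k P.
  by apply: contraTN up => nP; rewrite uE -mcoeff_eq0 hp.
have vP : vars_ge 0 'X_[u] by [].
have [r [g [hr _ hI]]] := suffix_spanP (leq0n n) k vP.
have rstd v : v \in msupp r -> exists2 R, v = mesym1 R & below k R.
  move=> /hr[R [-> _ hR]]; exists R => //; apply/belowP => t tn.
  by have := hR t tn; rewrite addn0.
have fI : squares_power_ideal K n k ('X_[u] - r).
  rewrite -[_ - r](subrK (suffix_sum 0 ^+ k * g)); apply: ideal_spanD.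
    by apply: ideal_span_sub hI => q hq; left.
  by rewrite mulrC; apply/ideal_spanM/ideal_span_gen; right.
have f0 : 'X_[u] - r != 0.
  apply/eqP => /(congr1 (mcoeff u)); rewrite mcoeffB mcoeffX eqxx mcoeff0.
  rewrite (memN_msupp_eq0 (p := r)) ?subr0; last first.
    apply/negP => /rstd[R]; rewrite uE => /inj_mesym1 PR; rewrite -PR => nR.
    by rewrite nR in nP.
  by move/eqP; rewrite oner_eq0.
have [v hv] := exists_leading le_term f0.
have nv := leading_nonstd le_term le_vars fI hv.
apply: ideal_span_gen; exists ('X_[u] - r), v; split=> //.
have : v \in msupp ('X_[u] - r) by case: hv.
move/msuppB_le; rewrite mem_cat msuppX inE => /orP[/eqP->//|/rstd[R vR nR]].
by have /eqP := nv R nR; rewrite vR mcoeffX eqxx oner_eq0.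
Qed.

End Initial.

(** * Counting critical cells *)

Definition bin_pred N i := if i is i'.+1 then 'C(N, i') else 0.

(** For k > 0, the coefficient of t^i in the k-th power of the Catalan series C. For k = i = 0 the
    truncated subtraction gives the right value 1. *)
Definition ballot k i := 'C(k + 2 * i - 1, i) - bin_pred (k + 2 * i - 1) i.

Lemma bin_pred_le k i : bin_pred (k + 2 * i - 1) i <= 'C(k + 2 * i - 1, i).
Proof.
case: i => // i /=; set N := (_ - 1).
have NE : N = k + i + i.+1 by rewrite /N; lia.
have := mul_bin_left N i; rewrite NE => h.
rewrite -(leq_pmul2l (ltn0Sn i)) h leq_mul2r; apply/orP; right; lia.
Qed.

Lemma ballotE k i : ballot k i + bin_pred (k + 2 * i - 1) i = 'C(k + 2 * i - 1, i).
Proof. by rewrite /ballot subnK // bin_pred_le. Qed.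

Lemma ballot0n k : ballot k 0 = 1.
Proof. by rewrite /ballot bin0. Qed.

Lemma bin_predS N i : 'C(N.+1, i) = 'C(N, i) + bin_pred N i.
Proof. by case: i => [|i]; rewrite ?bin0 // binS. Qed.

Lemma bin_predSS N i : bin_pred N.+1 i.+1 = 'C(N, i) + bin_pred N i.
Proof. exact: bin_predS. Qed.

(** Pascal's rule; in generating functions, C = 1 + t C^2 multiplied by C^k. *)
Lemma ballotS k i : ballot k.+1 i.+1 = ballot k i.+1 + ballot k.+2 i.
Proof.
have h1 := ballotE k.+1 i.+1; have h2 := ballotE k i.+1; have h3 := ballotE k.+2 i.
have E1 : k.+1 + 2 * i.+1 - 1 = (k + 2 * i.+1 - 1).+1 by lia.
have E3 : k.+2 + 2 * i - 1 = k + 2 * i.+1 - 1 by lia.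
rewrite E1 bin_predS bin_predSS in h1; rewrite E3 in h3.
rewrite /= in h1 h2; lia.
Qed.

Lemma ballot_zero i : ballot 0 i.+1 = 0.
Proof.
have h := ballotE 0 i.+1; rewrite /= in h.
have E : 0 + 2 * i.+1 - 1 = i + i.+1 by lia.
rewrite E in h; have := bin_sub (leq_addr i.+1 i); rewrite addKn; lia.
Qed.

(** C^k C^l = C^(k+l), by induction on i and then on k: [ballotS] lowers either k or i, at the price
    of raising k in the latter case. *)
Lemma ballot_conv k l i :
  \sum_(j < i.+1) ballot k j * ballot l (i - j) = ballot (k + l) i.
Proof.
elim: i k l => [|i IHi] k l.
  by rewrite big_ord1 !ballot0n.
elim: k => [|k IHk].
  rewrite big_ord_recl ballot0n mul1n subn0 big1 ?addn0 // => j _.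
  by rewrite ballot_zero.
rewrite big_ord_recl ballot0n subn0 /=.
under eq_bigr => j _ do rewrite ballotS mulnDl subSS.
rewrite big_split /= IHi addnA.
have -> : ballot (k.+1 + l) i.+1 = ballot (k + l) i.+1 + ballot (k.+2 + l) i.
  by rewrite !addSn ballotS.
congr (_ + _); rewrite -IHk big_ord_recl ballot0n subn0; congr (_ + _).
Qed.

Lemma catalanE i : catalan i = ballot 1 i.
Proof. by rewrite /catalan /ballot addKn. Qed.

Lemma catalan_convE l r : catalan_conv l r = ballot l.+1 r.
Proof.
rewrite /catalan_conv; set p := (\poly_(i < r.+1) catalan i)%R.
suff h i : i <= r -> ((p ^+ l.+1)`_i)%R = ballot l.+1 i by exact: h.
elim: l i => [|l IH] i ir.
  by rewrite GRing.expr1 coef_poly ltnS ir catalanE.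
rewrite GRing.exprSr coefM -[in RHS]addn1 -ballot_conv; apply: eq_bigr => j _.
rewrite IH ?coef_poly ?ltnS ?(leq_trans _ ir) ?catalanE //.
  by rewrite leq_subr.
by rewrite -ltnS.
Qed.

(** * Lattice walks and critical cells *)

Section Counting.
Variables (n k : nat).
Hypothesis k_gt0 : 0 < k.
Implicit Types (P T : {set 'I_n}).

Definition below_sets q s : {set {set 'I_n}} :=
  [set P | [&& below k P, #|P| == s & [forall x, (x \in P) ==> (x < q)]]].

Lemma prefix_card_bound P q p : (forall x, x \in P -> x < q) -> q <= p ->
  prefix_card P p = #|P|.
Proof.
move=> h qp; apply: eq_card => x; rewrite !inE; case: (boolP (x \in P)) => //= /h xq.
by rewrite (leq_trans xq).
Qed.

(** Sets are sorted by whether they contain the last index [q]. The hypothesis puts the endpoint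
    below k, so adding [q] is always allowed. *)
Lemma below_setsS (q : 'I_n) s : 2 * s.+1 < k + q.+1 ->
  #|below_sets q.+1 s.+1| = #|below_sets q s.+1| + #|below_sets q s|.
Proof.
move=> hs; rewrite -(cardsID [set P : {set 'I_n} | q \notin P]); congr (_ + _).
  apply: eq_card => P; rewrite !inE -!andbA; do 2!congr (_ && _).
  apply/andP/forallP => [[/forallP h qP] x|h].
    apply/implyP => xP; have := implyP (h x) xP; rewrite ltnS leq_eqVlt.
    by case/orP=> // /eqP/val_inj xq; rewrite -xq xP in qP.
  split; last by apply/negP => /(implyP (h q)); rewrite ltnn.
  by apply/forallP => x; apply/implyP => /(implyP (h x))/ltnW.
rewrite -[RHS](card_in_imset (f := fun P => q |: P)); last first.
  move=> P P'; rewrite !inE => /and3P[_ _ /forallP hP] /and3P[_ _ /forallP hP'] E.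
  have qP : q \notin P by apply/negP => /(implyP (hP q)); rewrite ltnn.
  have qP' : q \notin P' by apply/negP => /(implyP (hP' q)); rewrite ltnn.
  by rewrite -(setU1K qP) E setU1K.
apply: eq_card => P; rewrite !inE; apply/idP/imsetP => [|[P' + ->]].
  case/and4P; rewrite negbK => qP bP /eqP cP /forallP hP.
  exists (P :\ q); last by rewrite setD1K.
  rewrite inE (below_down _ bP) ?subD1set //=.
  rewrite -eqSS -cP (cardsD1 q P) qP eqxx /=.
  apply/forallP => x; apply/implyP; rewrite !inE => /andP[xq xP].
  have := implyP (hP x) xP; rewrite ltnS leq_eqVlt => /orP[/eqP/val_inj E|//].
  by rewrite E eqxx in xq.
rewrite inE => /and3P[bP /eqP cP /forallP hP].
have qP : q \notin P' by apply/negP => /(implyP (hP q)); rewrite ltnn.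
rewrite ?inE cardsU1 qP cP add1n !eqxx /=; apply/andP; split; last first.
  apply/forallP => x; rewrite !inE; apply/implyP => /orP[/eqP->//|].
  by move/(implyP (hP x))/ltnW.
apply/belowP => p pn; rewrite prefix_cardU1 //.
have [qp|_] := ltnP q p; last by have /belowP/(_ p pn) := bP.
have -> : prefix_card P' p = s; last by lia.
by rewrite -cP; apply: prefix_card_bound (ltnW qp) => x; apply/implyP.
Qed.

Lemma below_sets0 q : #|below_sets q 0| = 1.
Proof.
rewrite -(cards1 (set0 : {set 'I_n})); apply: eq_card => P; rewrite !inE cards_eq0.
case: eqP => [->|]; last by rewrite andbF.
rewrite below_card ?cards0 //=; apply/forallP => x; by rewrite inE.
Qed.

Lemma below_sets_max q s : q <= n -> k + q <= 2 * s -> #|below_sets q s| = 0.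
Proof.
move=> qn h; apply/eqP; rewrite cards_eq0; apply/eqP/setP => P; rewrite !inE.
apply/negP => /and3P[/belowP/(_ q qn) + /eqP cP /forallP hP].
by rewrite (@prefix_card_bound _ q) // ?cP ?ltnNge ?h // => x; apply/implyP.
Qed.

(* Reflection principle: 'C(q, s - k) counts the walks that do reach height k. *)
Lemma card_below_sets q s : q <= n -> 2 * s <= k + q ->
  #|below_sets q s| + (if k <= s then 'C(q, s - k) else 0) = 'C(q, s).
Proof.
elim: q s => [|q IH] s qn hs.
  have ks : (k <= s) = false by lia.
  rewrite ks addn0; case: s hs ks => [|s] hs ks; first by rewrite below_sets0.
  apply/eqP; rewrite cards_eq0; apply/eqP/setP => P; rewrite !inE.
  apply/negP => /and3P[_ /eqP cP /forallP hP].
  have /card_gt0P[x xP] : 0 < #|P| by rewrite cP.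
  by have := implyP (hP x) xP.
(* Here the endpoint has height exactly k: no walk qualifies, and the two binomials agree by
   symmetry. *)
have [hs'|hs'] := leqP (k + q.+1) (2 * s).
  rewrite below_sets_max // add0n; have E : 2 * s = k + q.+1 by lia.
  have [ks|ks] := leqP k s; last by rewrite bin_small //; lia.
  have -> : s - k = q.+1 - s by lia.
  by rewrite bin_sub //; lia.
case: s hs hs' => [|s] hs hs'.
  by rewrite below_sets0 bin0 leqNgt k_gt0.
rewrite (@below_setsS (Ordinal qn)) //= binS.
rewrite -(IH s.+1) ?(ltnW qn) //; last by lia.
rewrite -(IH s) ?(ltnW qn) //; last by lia.
have [ks|ks] := leqP k s; last first.
  rewrite addn0; case: ifP => ks'; last by rewrite !addn0.
  have -> : s.+1 - k = 0 by lia.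
  by rewrite !bin0 addnAC.
by rewrite (leqW ks) subSn // binS addnACA.
Qed.

Lemma card_below_ballot i : k + 2 * i - 1 <= n ->
  #|below_sets (k + 2 * i - 1) (k + i - 1)| = ballot k i.
Proof.
move=> qn; have := card_below_sets qn (s := k + i - 1); have := ballotE k i.
have -> : 'C(k + 2 * i - 1, k + i - 1) = 'C(k + 2 * i - 1, i).
  by rewrite -bin_sub; [congr ('C(_, _)); lia | lia].
move=> <- /(_ (ltac:(lia))); case: i {qn} => [|i] /=.
  by rewrite ifF ?addn0 //; lia.
have -> : k <= k + i.+1 - 1 by lia.
have -> : k + i.+1 - 1 - k = i by lia.
by move/eqP; rewrite eqn_add2r => /eqP.
Qed.

Lemma card_below_ballotS i : k + 2 * i <= n ->
  #|below_sets (k + 2 * i) (k + i - 1)| = ballot k i.+1.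
Proof.
move=> qn; have := card_below_sets qn (s := k + i - 1); have := ballotE k i.+1.
have -> : 'C(k + 2 * i, k + i - 1) = 'C(k + 2 * i, i.+1).
  by rewrite -bin_sub; [congr ('C(_, _)); lia | lia].
have -> : k + 2 * i.+1 - 1 = (k + 2 * i).+1 by lia.
rewrite binS /= bin_predS => h1 /(_ (ltac:(lia))) h2; move: h1 h2.
case: i {qn} => [|i] /=; first by rewrite ifF; lia.
have -> : k <= k + i.+1 - 1 by lia.
have -> : k + i.+1 - 1 - k = i by lia.
lia.
Qed.

Definition critk : {set 'I_n} -> {set 'I_n} -> bool := crit (below k).

Lemma critk_diag P : critk P P = below k P && (P != set0).
Proof. by rewrite /critk /crit eqxx andbT. Qed.

Lemma critk_below P T : critk P T -> below k P.
Proof. by case/and3P. Qed.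

(** Adding [t] makes the walk reach height k at some [p]; this lies beyond [t], as P itself is below
    k. *)
Lemma critk_offdiag P T : critk P T -> P != T -> exists (t : 'I_n) p,
  [/\ t \in T, t \notin P, (forall j : 'I_n, t < j -> (j \in P) = (j \in T)),
      t < p <= n & k + p <= 2 * (prefix_card P p).+1].
Proof.
case/and3P => bP _ /orP[/eqP->|]; first by rewrite eqxx.
case/existsP => t /and4P[tT tP /belowPn[p pn hp] /forallP tmax] _.
move: hp; rewrite prefix_cardU1 //; have [tp|pt] := ltnP t p => hp.
  exists t, p; split=> // [j tj|]; last by rewrite tp pn.
  by apply/eqP; apply: contraLR tj => /(implyP (tmax j)); rewrite -leqNgt.
by have /belowP/(_ p pn) := bP; rewrite ltnNge hp.
Qed.

Lemma card_eq_tail P T p : (forall j : 'I_n, p <= j -> (j \in P) = (j \in T)) ->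
  #|T| + prefix_card P p = #|P| + prefix_card T p.
Proof.
move=> h; pose Z := [set j : 'I_n | j < p].
have E (Q : {set 'I_n}) : #|Q| = prefix_card Q p + #|Q :\: Z|.
  rewrite -(cardsID Z Q); congr (#|pred_of_set _| + _).
  by apply/setP => x; rewrite !inE.
have -> : #|T| = prefix_card T p + #|P :\: Z|.
  rewrite (E T); congr (_ + #|pred_of_set _|); apply/setP => x.
  by rewrite !inE; case: (ltnP x p) => //= /h->.
by rewrite (E P); lia.
Qed.

(** P and T agree from [p] on, so #|T| - #|P| is at most p - [prefix_card P p]; the bound on k + p
    then gives the second inequality. The first uses that P has fewer than p elements before p. *)
Lemma critk_bounds P T : critk P T -> P != T ->
  k <= #|P|.+1 /\ #|T| + k <= 2 * #|P|.+1.
Proof.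
move=> c /(critk_offdiag c)[t [p [tT tP tmax /andP[tp pn] hp]]].
have hE := card_eq_tail (fun j pj => tmax j (leq_trans tp pj)).
have h1 := prefix_card_le P p; have h2 := prefix_card_leq T p.
have h3 : (prefix_card P p).+1 <= p.
  by have := prefix_card_leq (t |: P) p; rewrite prefix_cardU1 // tp.
by split; lia.
Qed.

(** Equality forces T to contain all of the first [p] indices and P to lie among them; as P and T
    agree from [p] on, T is exactly this segment. *)
Lemma critk_extremal P T : critk P T -> P != T -> #|T| + k = 2 * #|P|.+1 ->
  T = [set x : 'I_n | x < #|T|] /\ (forall x, x \in P -> x < #|T|).
Proof.
move=> c /(critk_offdiag c)[t [p [tT tP tmax /andP[tp pn] hp]]] E.
have hE := card_eq_tail (fun j pj => tmax j (leq_trans tp pj)).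
have h1 := prefix_card_le P p; have h2 := prefix_card_leq T p.
have P1 : prefix_card P p = #|P| by lia.
have T1 : prefix_card T p = p by lia.
have Tp : #|T| = p by lia.
have sub (Q : {set 'I_n}) : prefix_card Q p = #|Q| -> forall x, x \in Q -> x < p.
  move=> QE x xQ; have /setP/(_ x) : [set x in Q | x < p] = Q.
    apply/eqP; rewrite eqEcard; apply/andP; split; last by rewrite -QE.
    by apply/subsetP => y; rewrite inE => /andP[].
  by rewrite inE xQ.
rewrite Tp; split; last exact: sub.
apply/eqP; rewrite eqEcard; apply/andP; split.
  by apply/subsetP => x; rewrite inE; apply: sub; rewrite T1.
rewrite Tp; apply: leq_trans (prefix_card_leq setT p).
by apply: eq_leq; apply: eq_card => x; rewrite !inE.
Qed.

(** Here c is the column of the Betti diagram and a + 1 the row. *)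
Definition crit_count c a :=
  #|[set z : {set 'I_n} * {set 'I_n} | [&& critk z.1 z.2, #|z.2| == c.+1 & #|z.1| == a]]|.

Definition diag_count c a :=
  #|[set P : {set 'I_n} | [&& critk P P, #|P| == c.+1 & #|P| == a]]|.

Definition offdiag_count c a :=
  #|[set z : {set 'I_n} * {set 'I_n} |
     [&& critk z.1 z.2, z.1 != z.2, #|z.2| == c.+1 & #|z.1| == a]]|.

Lemma crit_countE c a : crit_count c a = diag_count c a + offdiag_count c a.
Proof.
rewrite /crit_count -(cardsID [set z | z.1 == z.2]); congr (_ + _).
  rewrite /diag_count -(card_imset _ (f := fun P => (P, P))); last by move=> P Q [].
  apply: eq_card => -[P T]; rewrite !inE /=; apply/idP/imsetP => [|[Q + [-> ->]]].
    by case/andP=> h /eqP E; subst T; exists P; rewrite ?inE.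
  by rewrite inE eqxx andbT.
by apply: eq_card => -[P T]; rewrite !inE /=; case: (P == T); rewrite ?andbF.
Qed.

Lemma diag_count_neq c a : a != c.+1 -> diag_count c a = 0.
Proof.
move=> h; apply: eq_card0 => P; rewrite !inE.
by apply/negP => /and3P[_ /eqP E /eqP E']; rewrite -E -E' eqxx in h.
Qed.

Lemma diag_count_small c : c.+1 < k -> diag_count c c.+1 = 'C(n, c.+1).
Proof.
move=> h; rewrite -[n in 'C(n, _)]card_ord -card_draws.
apply: eq_card => P; rewrite !inE critk_diag andbb.
case: (eqVneq #|P| c.+1) => [E|_]; last by rewrite andbF.
by rewrite below_card ?E //= -card_gt0 E.
Qed.

Lemma offdiag_count_small c a : a.+1 < k -> offdiag_count c a = 0.
Proof.
move=> h; apply: eq_card0 => -[P T]; rewrite !inE /=.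
by apply/negP => /and4P[cr PT _ /eqP aE]; have [] := critk_bounds cr PT; rewrite aE; lia.
Qed.

Lemma offdiag_count_large c a : 2 * a.+1 < c.+1 + k -> offdiag_count c a = 0.
Proof.
move=> h; apply: eq_card0 => -[P T]; rewrite !inE /=.
apply/negP => /and4P[cr PT /eqP tE /eqP aE].
by have [] := critk_bounds cr PT; rewrite tE aE; lia.
Qed.

Lemma crit_count_high c a : k + n <= 2 * a -> crit_count c a = 0.
Proof.
move=> h; apply: eq_card0 => -[P T]; rewrite !inE /=.
apply/negP => /and3P[/critk_below/belowP/(_ n (leqnn n)) + _ /eqP aE].
by rewrite prefix_card_all // aE ltnNge h.
Qed.

Lemma card_interval a b : b <= n -> #|[set x : 'I_n | a <= x < b]| = b - a.
Proof.
move=> bn; rewrite -(size_iota a (b - a)) cardE -(size_map val).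
apply/perm_size/uniq_perm; first by rewrite (map_inj_uniq val_inj) enum_uniq.
  exact: iota_uniq.
move=> x; rewrite mem_iota; apply/mapP/idP => [[y]|hx].
  rewrite mem_enum inE => /andP[h1 h2] ->.
  by rewrite h1 subnKC // ltnW // (leq_ltn_trans h1).
have xn : x < n by lia.
by exists (Ordinal xn) => //; rewrite mem_enum inE /=; lia.
Qed.

(** In the extremal case T is determined and P is any set below k inside it. Conversely, adding the
    largest element of T outside P brings the walk to height k at c + 1. *)
Lemma offdiag_count_last c a : c.+1 + k = 2 * a.+1 -> a < c.+1 -> c < n ->
  offdiag_count c a = #|below_sets c.+1 a|.
Proof.
move=> ca ac cn; pose T := [set x : 'I_n | x < c.+1].
have cT : #|T| = c.+1.
  by rewrite -[RHS]subn0 -(card_interval 0 cn); apply: eq_card => x; rewrite !inE.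
rewrite /offdiag_count -(card_imset _ (f := fun P => (P, T))); last by move=> P Q [].
apply: eq_card => -[P Q]; rewrite !inE /=; apply/idP/imsetP => [|[R + [-> ->]]].
  case/and4P => cr PQ /eqP qE /eqP aE.
  have [] := critk_extremal cr PQ; first by rewrite qE aE.
  rewrite qE => -> hP; exists P => //.
  rewrite inE (critk_below cr) aE eqxx /=.
  by apply/forallP => x; apply/implyP/hP.
rewrite inE => /and3P[bR /eqP Ra /forallP hR]; rewrite cT Ra !eqxx !andbT.
have RT : R != T by apply/eqP => E; move: Ra ac; rewrite E cT => ->; rewrite ltnn.
rewrite RT andbT /critk /crit bR -card_gt0 cT /= (negPf RT) /=.
have RsT : R \subset T by apply/subsetP => x; rewrite inE; apply/implyP.
have [x /setDP[xT xR]] : exists x, x \in T :\: R.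
  by apply/set0Pn; rewrite -subset0 subDset setU0; apply: contra RT => TR; rewrite eqEsubset RsT.
apply/existsP; exists [arg max_(i > x | (i \in T) && (i \notin R)) (i : nat)].
case: arg_maxnP => [|i /andP[iT iR] imax]; first by rewrite xT.
rewrite iT iR /=; apply/andP; split.
  apply/belowPn; exists c.+1 => //; rewrite prefix_cardU1 //.
  have -> : prefix_card R c.+1 = a.
    by rewrite -Ra; apply: prefix_card_bound (leqnn _) => y; apply/implyP.
  by move: iT; rewrite inE => ->; lia.
apply/forallP => j; apply/implyP => jRT; apply: imax.
have := subsetP RsT j; case: (j \in R) jRT; case: (j \in T) => //= _.
by move/(_ isT).
Qed.

(** With T a singleton, P lies before its element t. The walk of P is below k at t and adding t
    makes it reach k, so the size of P forces t = k + 2i - 1. *)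
Lemma offdiag_count0 i : k + 2 * i <= n ->
  offdiag_count 0 (k + i - 1) = #|below_sets (k + 2 * i - 1) (k + i - 1)|.
Proof.
move=> qn; have qn' : k + 2 * i - 1 < n by lia.
pose q := Ordinal qn'; rewrite /offdiag_count.
rewrite -(card_imset _ (f := fun P => (P, [set q]))); last by move=> P Q [].
apply: eq_card => -[P Q]; rewrite !inE /=; apply/idP/imsetP => [|[R + [-> ->]]].
  case/and4P => cr PQ /cards1P[t0 QE] /eqP aE; subst Q.
  have [t [p [+ tP tmax /andP[tp pn] hp]]] := critk_offdiag cr PQ.
  rewrite inE => /eqP tE; subst t0.
  have hP x : x \in P -> x < t.
    move=> xP; rewrite ltnNge leq_eqVlt; apply/negP => /orP[/eqP/val_inj E|tx].
      by rewrite E xP in tP.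
    by move: (tmax x tx); rewrite xP inE => /esym/eqP xt; move: tx; rewrite xt ltnn.
  have bP := critk_below cr.
  have h1 : prefix_card P p = #|P| by apply: prefix_card_bound hP (ltnW tp).
  have h2 : 2 * #|P| < k + t.
    have /belowP/(_ t (ltnW (ltn_ord t))) := bP.
    by rewrite (prefix_card_bound hP (leqnn t)).
  rewrite h1 aE in hp; rewrite aE in h2.
  have tq : t = q by apply: val_inj => /=; lia.
  exists P; last by rewrite tq.
  rewrite inE bP aE eqxx /=; apply/forallP => x; apply/implyP => /hP.
  by rewrite tq.
rewrite inE => /and3P[bR /eqP Ra /forallP hR].
have qR : q \notin R by apply/negP => /(implyP (hR q)); rewrite /= ltnn.
rewrite cards1 Ra !eqxx !andbT.
have -> : R != [set q] by apply: contraNneq qR => ->; rewrite inE.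
rewrite andbT /critk /crit bR /=; apply/andP; split.
  by apply/set0Pn; exists q; rewrite inE.
apply/orP; right; apply/existsP; exists q; rewrite inE eqxx qR /=.
apply/andP; split.
  apply/belowPn; exists q.+1 => //; rewrite prefix_cardU1 // ltnSn.
  rewrite (@prefix_card_bound R q) ?Ra //=; first by lia.
  by move=> x; apply/implyP.
apply/forallP => x; apply/implyP; rewrite inE.
case: (eqVneq x q) => [->//|_]; case: (boolP (x \in R)) => //= xR _.
by apply/ltnW/(implyP (hR x)).
Qed.

Lemma offdiag_count_pos c i : k + 2 * i <= n -> c < k + 2 * i ->
  0 < offdiag_count c (k + i - 1).
Proof.
move=> qn cq.
(* The walk of P descends i steps and then climbs to k - 1 at p - 1, so adding p - 1 reaches k. T
   consists of the last c + 1 indices before p. *)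
pose p := k + 2 * i; pose P : {set 'I_n} := [set x : 'I_n | i <= x < p - 1].
pose T : {set 'I_n} := [set x : 'I_n | p - c.+1 <= x < p].
have p1n : p - 1 < n by rewrite /p; lia.
pose t := Ordinal p1n.
have cP : #|P| = k + i - 1 by rewrite card_interval /p; lia.
have cT : #|T| = c.+1 by rewrite card_interval /p; lia.
have tT : t \in T by rewrite inE /= /p; lia.
have tP : t \notin P by rewrite inE /=; lia.
apply/card_gt0P; exists (P, T); rewrite inE /= cP cT !eqxx !andbT.
apply/andP; split; last by apply: contraNneq tP => ->.
apply/and3P; split; last (apply/orP; right; apply/existsP; exists t).
- apply/belowP => s sn.
  have h1 : prefix_card P s <= s - i.
    rewrite -(card_interval i sn); apply/subset_leq_card/subsetP => x.
    by rewrite !inE => /andP[/andP[-> _] ->].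
  have h2 := prefix_card_le P s; rewrite cP in h2; lia.
- by apply/set0Pn; exists t.
rewrite tT tP /=; apply/andP; split.
  apply/belowPn; exists p => //; rewrite prefix_cardU1 //=.
  rewrite (@prefix_card_bound P p) ?cP //; first by rewrite /p; lia.
  by move=> x; rewrite inE; lia.
by apply/forallP => x; apply/implyP; rewrite !inE /=; lia.
Qed.

End Counting.

(** * Entries of the Betti diagram *)

Section Diagram.
Variables (k m n : nat).
Hypotheses (hk : 2 <= k) (hn : n = k + 2 * m).
Local Notation N := (crit_count n k).

(** Above row k only the cells with P = T occur, which are those of the Koszul complex on the
    squares. *)
Lemma crit_count_low c a : a.+1 < k -> N c a = if a == c.+1 then 'C(n, a) else 0.
Proof.
move=> ak; rewrite crit_countE ?offdiag_count_small ?addn0 //; last exact: ltnW.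
by case: eqP => [E|/eqP/diag_count_neq//]; rewrite E diag_count_small // -E ltnW.
Qed.

Lemma crit_count_top c i : m < i -> N c (k + i - 1) = 0.
Proof. by move=> mi; apply: crit_count_high; lia. Qed.

(** The squares x_i^2 lie in a row from k on only if k = 2 and i = 0. *)
Lemma crit_count_col0 i : i <= m ->
  N 0 (k + i - 1) = (if (k == 2) && (i == 0) then n else 0) + catalan_conv (k - 1) i.
Proof.
move=> im; rewrite crit_countE; congr (_ + _).
  case: andP => [[/eqP k2 /eqP i0]|h].
    by rewrite k2 i0 diag_count_small // bin1.
  by apply: diag_count_neq; apply/eqP => E; apply: h; split; apply/eqP; lia.
rewrite offdiag_count0 ?card_below_ballot ?catalan_convE; try lia.
by congr ballot; lia.
Qed.

Lemma crit_count_last i : i <= m ->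
  N (k - 1 + 2 * i) (k + i - 1) = catalan_conv (k - 1) i.+1.
Proof.
move=> im; rewrite crit_countE diag_count_neq ?add0n; last by apply/eqP; lia.
rewrite offdiag_count_last; try lia.
have -> : (k - 1 + 2 * i).+1 = k + 2 * i by lia.
rewrite card_below_ballotS ?catalan_convE; try lia.
by congr ballot; lia.
Qed.

Lemma crit_count_beyond c i : k - 1 + 2 * i < c -> N c (k + i - 1) = 0.
Proof.
clear hn; move=> ic; rewrite crit_countE diag_count_neq ?add0n; last by apply/eqP; lia.
by apply: offdiag_count_large; lia.
Qed.

Lemma crit_count_pos c i : i <= m -> c <= k - 1 + 2 * i -> N c (k + i - 1) <> 0.
Proof.
move=> im ci; have h : 0 < offdiag_count n k c (k + i - 1).
  by apply: offdiag_count_pos; lia.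
by rewrite crit_countE; lia.
Qed.

End Diagram.

(** * The Betti diagram of the initial ideal *)

Theorem proposition4p16 (K : fieldType) (char0 : [pchar K]%R =i pred0)
    (k m n : nat) (hk : 2 <= k) (hn : n = k + 2 * m)
    (le : rel 'X_{1..n}) (le_term : term_order le)
    (le_vars : decreasing_vars le)
    (F : min_graded_free_res (initial_ideal le (squares_power_ideal K n k))) :
  let beta := graded_betti F in
  (* (1) *)
  [/\ (k = 2 -> beta 0 2 = n + 1),
      (2 < k -> beta 0 2 = n) &
      (forall j, k <= j <= k + m -> j <> 2 ->
        beta 0 j = catalan_conv (k - 1) (j - k))] /\
  (* (2) *)
  (forall i, 1 <= i -> i + 3 <= k ->
     beta i (2 * (i + 1)) = 'C(n, i + 1) /\
     (forall j, j < i + k -> j <> 2 * (i + 1) -> beta i j = 0)) /\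
  (* (3) *)
  (forall i, i <= m ->
     beta (k - 1 + 2 * i) (k - 1 + 2 * i + k + i)
       = catalan_conv (k - 1) (i + 1)) /\
  (* (4) *)
  (forall i, i <= m ->
     [/\ (forall j, j < k + i ->
            beta (k - 1 + 2 * i) (k - 1 + 2 * i + j) = 0),
         (forall j, k + i < j <= k + m ->
            beta (k - 1 + 2 * i) (k - 1 + 2 * i + j) <> 0),
         (forall j, k - 1 + 2 * i < j -> beta j (j + (k + i)) = 0) &
         (forall j, j < k - 1 + 2 * i -> beta j (j + (k + i)) <> 0)]) /\
  (* shape of the Betti diagram; entry (column i, row r) is beta i (i + r),
     and the first clause says that no row of negative index is non-zero *)
  [/\ (forall i j, j < i -> beta i j = 0),
      (forall r, (exists i, beta i (i + r) <> 0) <-> 2 <= r <= k + m),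
      (forall r, 2 <= r < k ->
         (forall i, beta i (i + r) <> 0 <-> i = r - 2) /\
         (r = 2 -> beta 0 r = n)) &
      (forall i, i <= m ->
         [/\ (forall c, beta c (c + (k + i)) <> 0 <-> c <= k - 1 + 2 * i),
             beta 0 (k + i) =
               (if (k == 2) && (i == 0) then n + 1
                else catalan_conv (k - 1) i) &
             beta (k - 1 + 2 * i) (k - 1 + 2 * i + (k + i))
               = catalan_conv (k - 1) (i + 1)])].
Proof.
move=> beta.
have n0 : 0 < n by lia.
(* A cell in column i and degree j has #|P| = j - (i + 1). For j <= i the truncated difference would
   be 0, so this case is kept apart. *)
have betaE i j : beta i j = if i < j then crit_count n k i (j - i.+1) else 0.
  rewrite /beta (@betti_crit K n (below k) (Ordinal n0)).
  - rewrite /crit_count; case: ifP => ij.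
      apply: eq_card => z; rewrite !inE; congr (_ && _).
      by case: eqP => //= ->; apply/eqP/eqP; lia.
    apply: eq_card0 => z; rewrite !inE.
    by apply/negP => /and3P[_ /eqP h1 /eqP h2]; lia.
  - by move=> P Q; apply: below_down.
  - by move=> P a b; apply: below_stable.
  - by rewrite below_card // cards0; lia.
  - by move=> p; apply: initial_idealE.
have row c r : 0 < r -> beta c (c + r) = crit_count n k c (r - 1).
  move=> r0; rewrite betaE ifT; last by lia.
  by congr crit_count; lia.
have row0 c : beta c (c + 0) = 0 by rewrite betaE addn0 ltnn.
have low c r : 0 < r < k ->
    beta c (c + r) = if r == c + 2 then 'C(n, r - 1) else 0.
  move=> /andP[r0 rk]; rewrite row // (crit_count_low n hk); last by lia.
  by congr (if _ then _ else _); apply/eqP/eqP; lia.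
have high c r : k + m < r -> beta c (c + r) = 0.
  move=> h; rewrite row; last by lia.
  have -> : r - 1 = k + (r - k) - 1 by lia.
  by apply: crit_count_top; try exact: hn; lia.
have rowk c i : beta c (c + (k + i)) = crit_count n k c (k + i - 1).
  by rewrite row //; lia.
have last_entry i : i <= m ->
    beta (k - 1 + 2 * i) (k - 1 + 2 * i + (k + i)) = catalan_conv (k - 1) (i + 1).
  by move=> im; rewrite rowk (crit_count_last hk hn im) addn1.
have beyond i c : k - 1 + 2 * i < c -> beta c (c + (k + i)) = 0.
  by move=> ic; rewrite rowk (crit_count_beyond n hk ic).
have pos i c : i <= m -> c <= k - 1 + 2 * i -> beta c (c + (k + i)) <> 0.
  by move=> im ci; rewrite rowk; apply: (crit_count_pos hk hn).
have col0 i : i <= m -> beta 0 (k + i) =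
    (if (k == 2) && (i == 0) then n else 0) + catalan_conv (k - 1) i.
  by move=> im; rewrite -[k + i]add0n rowk (crit_count_col0 hk hn im).
have conv0 : catalan_conv (k - 1) 0 = 1 by rewrite catalan_convE ballot0n.
have b02 : 2 < k -> beta 0 2 = n.
  by move=> k2; rewrite -[2]add0n low //= bin1.
split; [split=> // [k2|j /andP[kj jm] j2]|split; [|split; [|split]]].
- have := col0 0 (leq0n m); rewrite addn0 k2 /= => ->.
  by rewrite -k2 conv0.
- have := col0 (j - k); rewrite subnKC // => ->; last by lia.
  by rewrite ifF //; apply/negP => /andP[/eqP h1 /eqP h2]; lia.
- move=> i i1 ik; split.
    have -> : 2 * (i + 1) = i + (i + 2) by lia.
    by rewrite low ?eqxx; [congr 'C(_, _); lia | lia].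
  move=> j jk j2; rewrite betaE; case: ifP => // ij.
  rewrite (crit_count_low n hk); [rewrite ifF // | lia].
  by apply/negP => /eqP; lia.
- by move=> i im; rewrite -addnA last_entry.
- move=> i im; split=> [j ji|j /andP[ij jm]|j|j ji].
  + have [j0|j0] := posnP j; first by rewrite j0 row0.
    have [jk|kj] := ltnP j k.
      by rewrite low ?j0 // ifF //; apply/negP => /eqP; lia.
    by have := @beyond (j - k) (k - 1 + 2 * i); rewrite subnKC //; apply; lia.
  + by have := @pos (j - k) (k - 1 + 2 * i); rewrite subnKC; [apply; lia | lia].
  + exact: beyond.
  + by apply: pos => //; apply: ltnW.
- split.
  + by move=> i j ji; rewrite betaE ltnNge ltnW.
  + move=> r; split=> [[c h]|/andP[r2 rm]].
      have [r0|r0] := posnP r; first by case: h; rewrite r0 row0.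
      have [rk|kr] := ltnP (k + m) r; first by case: h; apply: high.
      rewrite andbT; case: ltnP => // r1; case: h; rewrite low ?ifF //; last by lia.
      by apply/negP => /eqP; lia.
    have [rk|kr] := ltnP r k.
      exists (r - 2); rewrite low ?ifT; [|lia|by apply/eqP; lia].
      by apply/eqP; rewrite -lt0n bin_gt0; lia.
    by exists 0; have := @pos (r - k) 0; rewrite subnKC //; apply; lia.
  + move=> r /andP[r2 rk]; split=> [c|r2'].
      rewrite low; last by lia.
      case: eqP => [E|E]; split=> // h; try by lia.
      by apply/eqP; rewrite -lt0n bin_gt0; lia.
    by rewrite r2' b02 //; lia.
  + move=> i im; split=> [c||]; last exact: last_entry.
      split=> [h|]; last exact: pos.
      by rewrite leqNgt; apply/negP => /beyond.
    rewrite col0 //; case: ifP => // /andP[_ /eqP->].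
    by rewrite conv0.
Qed.
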